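(* Let $P$ be a Hanner polytope or a Birkhoff polytope $B_n$ with $n\geq 2$, and let $d$ be the dimension of $P$. Then $f_0(P)f_{d-1}(P)\leq d2^{d+1}$, and equality is achieved if and only if $P$ is affinely isomorphic to the $d$-dimensional cross-polytope or the $d$-dimensional cube.
   Context: For a $d$-dimensional polytope $P$, $f_0(P)$ is its number of vertices and $f_{d-1}(P)$ its number of facets. The polar of a polytope $P\subseteq\mathbb{R}^d$ is $P^{\triangle}=\{y\in\mathbb{R}^d:x^\intercal y\leq 1\text{ for all }x\in P\}$. The $d$-dimensional cube is $[-1,1]^d$ and the $d$-dimensional cross-polytope is its polar. The Cartesian product of polytopes $P_1\subseteq\mathbb{R}^{d_1}$ and $P_2\subseteq\mathbb{R}^{d_2}$ is $P_1\times P_2=\{(x,y)\in\mathbb{R}^{d_1+d_2}:x\in P_1,\ y\in P_2\}$. Hanner polytopes form the smallest family of polytopes that contains the segment $[-1,1]$ of dimension 1 and is closed under taking polars and Cartesian products. The Birkhoff polytope $B_n\subset\mathbb{R}^{n^2}$ is the convex hull of all $n\times n$ permutation matrices. *)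

(* Defs.v *)
From mathcomp Require Import all_boot all_order all_algebra all_fingroup.
From mathcomp Require Import finmap all_classical all_reals convex.

Set Implicit Arguments.
Unset Strict Implicit.
Unset Printing Implicit Defensive.

Import Order.TTheory GRing.Theory Num.Theory.

Local Open Scope classical_set_scope.
Local Open Scope ring_scope.

(* Throughout, R^N is the space 'rV[R]_N of row vectors. *)

Definition dotp (R : realType) (N : nat) (x y : 'rV[R]_N) : R :=
  \sum_i x 0 i * y 0 i.

Definition conv_hull (R : realType) (N : nat) (A : set 'rV[R]_N) :
    set 'rV[R]_N :=
  smallest (@convex_set R 'rV[R]_N) A.

Definition affine_set (R : realType) (N : nat) (A : set 'rV[R]_N) : Prop :=
  forall (x y : 'rV[R]_N) (t : R), A x -> A y -> A (t *: x + (1 - t) *: y).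

Definition affine_hull (R : realType) (N : nat) (A : set 'rV[R]_N) :
    set 'rV[R]_N :=
  smallest (@affine_set R N) A.

(* The affine hull of A is a translate of a k-dimensional linear subspace (the
   row space of U). No k satisfies this when A is empty, so the empty face of a
   polytope is never counted in [f_num] below. *)
Definition has_dim (R : realType) (N : nat) (A : set 'rV[R]_N) (k : nat) :
    Prop :=
  exists (x : 'rV[R]_N) (U : 'M[R]_N),
    \rank U = k /\ affine_hull A = [set x + u | u in [set u | (u <= U)%MS]].

(* c may be 0, so P itself and the empty set are faces of P. *)
Definition face (R : realType) (N : nat) (P F : set 'rV[R]_N) : Prop :=
  exists (c : 'rV[R]_N) (delta : R),
    (forall x, P x -> dotp c x <= delta) /\
    F = P `&` [set x | dotp c x = delta].

(* The number of k-dimensional faces. [fset_set] sends infinite sets to the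
   empty one, which is harmless since a polytope has finitely many faces. *)
Definition f_num (R : realType) (N : nat) (k : nat) (P : set 'rV[R]_N) : nat :=
  #|` fset_set [set F | face P F /\ has_dim F k]|.

Definition polar (R : realType) (N : nat) (P : set 'rV[R]_N) : set 'rV[R]_N :=
  [set y | forall x, P x -> dotp x y <= 1].

Definition cube (R : realType) (d : nat) : set 'rV[R]_d :=
  [set x | forall i, -1 <= x 0 i <= 1].

Definition cross_polytope (R : realType) (d : nat) : set 'rV[R]_d :=
  polar (@cube R d).

Definition cartesian (R : realType) (m n : nat)
    (P : set 'rV[R]_m) (Q : set 'rV[R]_n) : set 'rV[R]_(m + n) :=
  [set row_mx x y | x in P & y in Q].

Inductive hanner (R : realType) : forall N : nat, set 'rV[R]_N -> Prop :=
| hanner_segment : hanner (@cube R 1)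
| hanner_polar N (P : set 'rV[R]_N) : hanner P -> hanner (polar P)
| hanner_cartesian m n (P : set 'rV[R]_m) (Q : set 'rV[R]_n) :
    hanner P -> hanner Q -> hanner (cartesian P Q).

(* n x n matrices are read as points of R^(n * n) through [mxvec]. *)
Definition birkhoff (R : realType) (n : nat) : set 'rV[R]_(n * n) :=
  conv_hull [set mxvec (perm_mx s) | s in [set: 'S_n]].

(* An inductive family rather than an equation P = birkhoff R n, because the
   ambient dimension n * n is an index of the type of P. *)
Inductive is_birkhoff (R : realType) : forall N : nat, set 'rV[R]_N -> Prop :=
| IsBirkhoff n : (2 <= n)%N -> is_birkhoff (@birkhoff R n).

Definition affinely_isomorphic (R : realType) (m n : nat)
    (P : set 'rV[R]_m) (Q : set 'rV[R]_n) : Prop :=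
  exists (A : 'M[R]_(m, n)) (b : 'rV[R]_n),
    set_bij P Q (fun x => x *m A + b).

(* Main.v *)
Require Import Defs.
From mathcomp Require Import all_boot all_order all_algebra all_fingroup.
From mathcomp Require Import finmap all_classical all_reals convex.
From mathcomp Require Import interval_inference zify ring lra.

Set Implicit Arguments.
Unset Strict Implicit.
Unset Printing Implicit Defensive.

Import Order.TTheory GRing.Theory Num.Theory.

(** Write v and f for the numbers of vertices and facets of a polytope of
    dimension d.

    Hanner polytopes.  Every Hanner polytope P in R^d carries a pair (V, F) of
    finite sets with P = conv V = {x | f.x <= 1 for f in F}; V is the vertex set
    and F is the set of facet normals, that is, the vertex set of the polar.
    Polarity exchanges V and F; a product has vertex set V x W and facet normals
    F x 0 together with 0 x G.  So (v, f) becomes (f, v) under polarity and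
    (v w, f + g) under products, and three bounds propagate together:
    v <= 2^d, f <= 2^d and v f <= d 2^(d+1), because
      v w (f + g) = w (v f) + v (w g) <= 2^b a 2^(a+1) + 2^a b 2^(b+1).
    Equality forces v = 2^a, f = 2a, w = 2^b, g = 2b, and a Hanner polytope with
    these counts is a linear image of a cube.  The dual extremal counts (2d, 2^d)
    occur for a product only when both factors are segments, since
    2^a + 2^b >= 2^(a+b) forces a = b = 1; the square is also a cross-polytope.
    These steps are [dual_pair_prod], [extremal_counts_cartesian] and
    [hanner_counts].

    Birkhoff polytopes.  B_n has n! vertices, dimension at least (n-1)^2 and at
    most n^2 facets, each cut out by an equation x_ij = 0.  For the last bound, let F be a
    facet contained in no set x_ij = 0.  Then every position (i, j) is used by a
    permutation matrix of F.  The sum M of n^2 such matrices is positive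
    everywhere, so for every permutation t the matrix M - t is nonnegative with
    all line sums n^2 - 1, hence a sum of n^2 - 1 permutation matrices (Hall and
    Konig).  Comparing values of the functional that defines F shows that t is in
    F, so F is all of B_n, which is absurd.  For n >= 3 this gives
    n! n^2 < d 2^(d+1), while B_2 is a segment.

    That cubes and cross-polytopes attain the bound in every affine copy follows
    from the invariance of face numbers under affine isomorphism
    ([affine_invariance]); it also rules them out for n >= 3. *)

(** * Inner products and convex hulls *)

Section Dotp.
Local Open Scope classical_set_scope.
Local Open Scope ring_scope.
Variable R : realType.
Implicit Types (N k : nat) (a t : R).

Lemma dotpE N (x y : 'rV[R]_N) : dotp x y = (x *m y^T) 0 0.
Proof. by rewrite mxE; apply: eq_bigr => i _; rewrite mxE. Qed.

Lemma dotpC N (x y : 'rV[R]_N) : dotp x y = dotp y x.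
Proof. by apply: eq_bigr => i _; rewrite mulrC. Qed.

Lemma dotpDr N (x y z : 'rV[R]_N) : dotp x (y + z) = dotp x y + dotp x z.
Proof. by rewrite !dotpE linearD mulmxDr mxE. Qed.

Lemma dotpZr N a (x y : 'rV[R]_N) : dotp x (a *: y) = a * dotp x y.
Proof. by rewrite !dotpE linearZ -scalemxAr mxE. Qed.

Lemma dotpNr N (x y : 'rV[R]_N) : dotp x (- y) = - dotp x y.
Proof. by rewrite -scaleN1r dotpZr mulN1r. Qed.

Lemma dotpBr N (x y z : 'rV[R]_N) : dotp x (y - z) = dotp x y - dotp x z.
Proof. by rewrite dotpDr dotpNr. Qed.

Lemma dotp0r N (x : 'rV[R]_N) : dotp x 0 = 0.
Proof. by rewrite -(scale0r 0) dotpZr mul0r. Qed.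

Lemma dotpNl N (x y : 'rV[R]_N) : dotp (- x) y = - dotp x y.
Proof. by rewrite dotpC dotpNr dotpC. Qed.

Lemma dotp0l N (x : 'rV[R]_N) : dotp 0 x = 0.
Proof. by rewrite dotpC dotp0r. Qed.

Lemma dotp_mulmx N k (x : 'rV[R]_N) (y : 'rV[R]_k) (A : 'M[R]_(k, N)) :
  dotp x (y *m A) = dotp (x *m A^T) y.
Proof. by rewrite !dotpE trmx_mul mulmxA. Qed.

Lemma dotp_row_mx N k (x1 y1 : 'rV[R]_N) (x2 y2 : 'rV[R]_k) :
  dotp (row_mx x1 x2) (row_mx y1 y2) = dotp x1 y1 + dotp x2 y2.
Proof. by rewrite !dotpE tr_row_mx mul_row_col mxE. Qed.

Lemma dotp_gt0 N (x : 'rV[R]_N) : x != 0 -> 0 < dotp x x.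
Proof.
move=> x0; have /rV0Pn[i xi0] := x0.
rewrite /dotp (bigD1 i) //= ltr_pwDl //.
  by rewrite -expr2 exprn_even_gt0.
by apply: sumr_ge0 => j _; rewrite -expr2 exprn_even_ge0.
Qed.

(** A functional vanishing on spanning vectors vanishes on their span. *)
Lemma submx_dotp0 N k (u c : 'rV[R]_N) (W : 'M[R]_(k, N)) :
  (u <= W)%MS -> (forall i, dotp c (row i W) = 0) -> dotp c u = 0.
Proof.
move=> /submxP[D ->] cW; rewrite dotpE trmx_mul mulmxA.
suff -> : c *m W^T = 0 by rewrite mul0mx mxE.
apply/rowP => i; rewrite [RHS]mxE -(cW i) mxE.
by apply: eq_bigr => j _; rewrite !mxE.
Qed.

End Dotp.

Section Convexity.
Local Open Scope classical_set_scope.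
Local Open Scope ring_scope.
Variables (R : realType) (N : nat).
Implicit Types (A K : set 'rV[R]_N) (c g x y v : 'rV[R]_N) (t delta : R).

Lemma convexP A : convex_set A <->
  (forall x y t, A x -> A y -> 0 <= t <= 1 -> A (t *: x + (1 - t) *: y)).
Proof.
split=> [cA x y t Ax Ay /andP[t0 t1] | cA x y t /set_mem Ax /set_mem Ay].
- exact: set_mem (cA x y (Itv01 t0 t1) (mem_set Ax) (mem_set Ay)).
- by apply/mem_set/cA => //; apply/andP; split => //.
Qed.

Lemma conv_hull_sub A x : A x -> conv_hull A x.
Proof. exact: sub_gen_smallest. Qed.

Lemma conv_hull_convex A : convex_set (conv_hull A).
Proof.
apply/convexP => x y t Ax Ay t01 K [cK AK].
by move/convexP: (cK); apply => //; [apply: Ax | apply: Ay].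
Qed.

Lemma conv_hull_ind A K x : conv_hull A x ->
  (forall x y t, K x -> K y -> 0 <= t <= 1 -> K (t *: x + (1 - t) *: y)) ->
  (forall v, A v -> K v) -> K x.
Proof. by move=> Ax cK AK; apply: Ax; split=> //; apply/convexP. Qed.

Lemma conv_hull_le A c delta x : conv_hull A x ->
  (forall v, A v -> dotp c v <= delta) -> dotp c x <= delta.
Proof.
move=> Ax cA; pose K := [set y | dotp c y <= delta].
apply: (@conv_hull_ind _ K _ Ax) => //= {x Ax}.
move=> x y t cx cy /andP[t0 t1].
rewrite /K /= in cx cy *.
by rewrite dotpDr !dotpZr; nra.
Qed.

Lemma conv_hull_ge A c delta x : conv_hull A x ->
  (forall v, A v -> delta <= dotp c v) -> delta <= dotp c x.
Proof.
move=> Ax cA; rewrite -lerN2 -dotpNl; apply: (conv_hull_le Ax) => v Av.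
by rewrite dotpNl lerN2 cA.
Qed.

(** The points of a hull at which a functional attains its maximum come from the
    generators with the same property: the points y with c.y <= delta that lie
    in K as soon as c.y = delta form a convex set.  With K empty, a nonempty
    face contains a generator; with K a point, exposed generators are vertices. *)
Lemma conv_hull_face A K c delta x :
    convex_set K -> (forall v, A v -> dotp c v <= delta) ->
    (forall v, A v -> dotp c v = delta -> K v) ->
  conv_hull A x -> dotp c x = delta -> K x.
Proof.
move=> /convexP cK cA KA Ax.
suff [_] : dotp c x <= delta /\ (dotp c x = delta -> K x) by [].
pose K' := [set y | dotp c y <= delta /\ (dotp c y = delta -> K y)].
apply: (@conv_hull_ind _ K' _ Ax); last first.
  by move=> v Av; split; [apply: cA | apply: KA].
move=> {x Ax} x y t [cx Kx] [cy Ky] /andP[t0 t1]; rewrite /K' /= dotpDr !dotpZr.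
split; first by nra.
move=> txy; have [t_eq0|tn0] := eqVneq t 0.
  rewrite t_eq0 scale0r add0r subr0 scale1r; apply: Ky.
  by rewrite t_eq0 in txy; lra.
have [t_eq1|tn1] := eqVneq t 1.
  rewrite t_eq1 subrr scale0r addr0 scale1r; apply: Kx.
  by rewrite t_eq1 in txy; lra.
have {tn0}t0 : 0 < t by rewrite lt_neqAle eq_sym tn0.
have {tn1}t1 : t < 1 by rewrite lt_neqAle tn1.
apply: cK; [apply: Kx | apply: Ky | by rewrite !ltW].
  by apply/eqP; rewrite eq_le cx /=; nra.
by apply/eqP; rewrite eq_le cy /=; nra.
Qed.

End Convexity.
(** * Dimension *)

Section Dimension.
Local Open Scope classical_set_scope.
Local Open Scope ring_scope.
Variables (R : realType) (N : nat).
Implicit Types (A B F G P : set 'rV[R]_N) (a x y c : 'rV[R]_N) (k l m : nat).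

(** The rows of W are differences of points of A that span all such differences,
    so that the dimension of A is a matrix rank. *)
Definition spans_at A a m (W : 'M[R]_(m, N)) : Prop :=
  [/\ A a, forall i, A (a + row i W) & forall x, A x -> (x - a <= W)%MS].

(** Take independent differences in maximal number. *)
Lemma spans_at_exists A a : A a -> exists m (W : 'M[R]_(m, N)), spans_at A a W.
Proof.
move=> Aa.
pose P k := `[< exists m (W : 'M[R]_(m, N)),
  (forall i, A (a + row i W)) /\ \rank W = k >].
have exP : exists k, P k.
  by exists 0%N; apply/asboolP; exists 0%N, 0; split=> [[]|] //; rewrite mxrank0.
have leP k : P k -> (k <= N)%N.
  by move=> /asboolP[m [W [_ <-]]]; apply: rank_leq_col.
have [k /asboolP[m [W [AW rW]]] kmax] := ex_maxnP exP leP.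
exists m, W; split=> // x Ax; apply/negPn/negP => xW.
have : P (\rank (col_mx W (x - a))).
  apply/asboolP; exists (m + 1)%N, (col_mx W (x - a)); split=> // i.
  case: (split_ordP i) => j ->; rewrite (rowKu, rowKd) //.
  by rewrite row_id addrC subrK.
move=> /kmax; rewrite -rW leqNgt => /negP; apply.
rewrite -addsmxE; apply: rank_ltmx; rewrite ltmxE addsmxSl /=.
by apply: contra xW; apply: submx_trans; rewrite addsmxSr.
Qed.

(** An affine set through a is stable, relative to a, under scaling (combine with
    a itself) and under addition (scale a midpoint by 2); hence it contains all
    linear combinations of the rows of W. *)
Lemma affine_hull_spans_at A a m (W : 'M[R]_(m, N)) : spans_at A a W ->
  affine_hull A = [set x | (x - a <= W)%MS].
Proof.
move=> [Aa AW WA]; apply/seteqP; split=> [|x /= xW].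
  apply: smallest_sub => // x y t /= xW yW.
  have -> : t *: x + (1 - t) *: y - a = t *: (x - a) + (1 - t) *: (y - a).
    by apply/rowP => i; rewrite !mxE; ring.
  by rewrite addmx_sub // scalemx_sub.
move=> K [/= Kaff AK].
have KZ t u : K (a + u) -> K (a + t *: u).
  move=> Ku; have := Kaff _ _ t Ku (AK _ Aa).
  by rewrite scalerDr addrAC -scalerDl subrKC scale1r.
have KD u v : K (a + u) -> K (a + v) -> K (a + (u + v)).
  move=> Ku Kv; have Kuv := Kaff _ _ 2^-1 Ku Kv.
  have -> : a + (u + v) = a + 2 *: (2^-1 *: (u + v)).
    by rewrite scalerA divff ?scale1r // pnatr_eq0.
  apply: KZ; congr (K _): Kuv; apply/rowP => i; rewrite !mxE; lra.
suff: K (a + (x - a)) by rewrite subrKC.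
have /submxP[D ->] := xW.
rewrite mulmx_sum_row; apply: (big_ind (fun u => K (a + u))) => [||i _].
- by rewrite addr0; apply: AK.
- exact: KD.
- by apply/KZ/AK.
Qed.

Lemma has_dim_spans_at A a m (W : 'M[R]_(m, N)) k : spans_at A a W ->
  has_dim A k <-> \rank W = k.
Proof.
move=> AW; have hullE := affine_hull_spans_at AW; split=> [[x [U [rU]]]|rW].
  rewrite {}hullE => WU; rewrite -rU; apply: eqmx_rank.
  have /= WUP y : (y - a <= W)%MS <-> (y - x <= U)%MS.
    have -> : (y - a <= W)%MS <-> [set x + u | u in [set u | (u <= U)%MS]] y.
      by rewrite -WU.
    split=> [[u /= uU <-]|yU]; first by rewrite addrC addKr.
    by exists (y - x) => //; rewrite subrKC.
  have aU : (a - x <= U)%MS by apply/WUP; rewrite subrr sub0mx.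
  have xW : (x - a <= W)%MS by apply/WUP; rewrite subrr sub0mx.
  apply/andP; split; apply/row_subP => i.
    have /WUP Wi : (a + row i W - a <= W)%MS by rewrite addrC addKr row_sub.
    have -> : row i W = (a + row i W - x) - (a - x).
      by apply/rowP => j; rewrite !mxE; ring.
    by rewrite addmx_sub // eqmx_opp.
  have /WUP Ui : (x + row i U - x <= U)%MS by rewrite addrC addKr row_sub.
  have -> : row i U = (x + row i U - a) - (x - a).
    by apply/rowP => j; rewrite !mxE; ring.
  by rewrite addmx_sub // eqmx_opp.
exists a, (<<W>>%MS); split; first by rewrite genmxE.
rewrite hullE; apply/seteqP; split=> [x /= xW | _ [u /= uW <-] /=].
  by exists (x - a); rewrite /= ?genmxE // subrKC.
by rewrite addrC addKr -(genmxE W).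
Qed.

Lemma has_dim_neq0 A k : has_dim A k -> exists a, A a.
Proof.
move=> [x [U [_ hullE]]]; apply/not_existsP => A0.
have : affine_hull A x.
  by rewrite hullE; exists 0; rewrite ?addr0 //= sub0mx.
by move=> /(_ set0); apply; split=> // y /A0.
Qed.

Lemma has_dim_inj A k l : has_dim A k -> has_dim A l -> k = l.
Proof.
move=> Ak; have [a Aa] := has_dim_neq0 Ak.
have [m [W AW]] := spans_at_exists Aa.
by move: Ak => /(has_dim_spans_at _ AW) <- /(has_dim_spans_at _ AW) <-.
Qed.

Lemma has_dim_exists A a : A a -> exists k, has_dim A k.
Proof.
move=> Aa; have [m [W AW]] := spans_at_exists Aa.
by exists (\rank W); apply/(has_dim_spans_at _ AW).
Qed.

Lemma has_dim_le A B k l : A `<=` B -> has_dim A k -> has_dim B l -> (k <= l)%N.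
Proof.
move=> AB Ak Bl; have [a Aa] := has_dim_neq0 Ak.
have [m [W AW]] := spans_at_exists Aa.
have [n [V BV]] := spans_at_exists (AB _ Aa).
move: Ak Bl => /(has_dim_spans_at _ AW) <- /(has_dim_spans_at _ BV) <-.
apply/mxrankS/row_subP => i; case: AW BV => _ AW _ [_ _ BV].
by have := BV _ (AB _ (AW i)); rewrite addrC addKr.
Qed.

(** A nonempty face is the trace on P of a hyperplane or of the whole space; a larger set
    of the same dimension has the same affine hull, hence satisfies the same
    equation.  This is used both to show that a proper face has smaller dimension
    and to identify a facet from an inclusion. *)
Lemma face_eq_of_dim P F G k : face P F -> F `<=` G -> G `<=` P ->
  has_dim F k -> has_dim G k -> F = G.
Proof.
move=> [c [delta [cP FE]]] FG GP Fk Gk; have [a Fa] := has_dim_neq0 Fk.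
have [m [W FW]] := spans_at_exists Fa.
have [n [V GV]] := spans_at_exists (FG _ Fa).
move: Fk Gk => /(has_dim_spans_at _ FW) rW /(has_dim_spans_at _ GV) rV.
case: FW GV => _ FW _ [_ _ GV].
have WV : (W <= V)%MS.
  by apply/row_subP => i; have := GV _ (FG _ (FW i)); rewrite addrC addKr.
have VW : (V <= W)%MS by rewrite -(mxrank_leqif_sup WV).2 rW rV.
apply/seteqP; split=> // x Gx.
have cF y : F y -> dotp c y = delta by rewrite FE => -[].
rewrite FE; split; first exact: GP.
have : dotp c (x - a) = 0.
  apply: submx_dotp0 (submx_trans (GV _ Gx) VW) _ => i.
  by have := cF _ (FW i); rewrite dotpDr (cF _ Fa); lra.
by rewrite dotpBr (cF _ Fa) => /subr0_eq.
Qed.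

Lemma has_dim0P A : has_dim A 0 <-> exists a, A = [set a].
Proof.
split=> [A0|[a ->]].
  have [a Aa] := has_dim_neq0 A0; exists a.
  have [m [W AW]] := spans_at_exists Aa.
  move: A0 => /(has_dim_spans_at _ AW) /eqP; rewrite mxrank_eq0 => /eqP W0.
  apply/seteqP; split=> [x /= Ax | _ /= ->] //; case: AW => _ _ /(_ _ Ax).
  by rewrite W0 => /submx0null /subr0_eq.
have aW : spans_at [set a] a (0 : 'M[R]_(0, N)).
  by split=> [//|[]//|x /= ->]; rewrite subrr sub0mx.
by apply/(has_dim_spans_at _ aW); rewrite mxrank0.
Qed.

End Dimension.
(** * Counting vertices and facets *)

Section Counting.
Local Open Scope classical_set_scope.
Local Open Scope ring_scope.
Variables (R : realType) (N : nat).
Implicit Types (A P F : set 'rV[R]_N) (a x y z u v w f c : 'rV[R]_N).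
Implicit Types (V L : seq 'rV[R]_N).

Definition halfspaces L : set 'rV[R]_N :=
  [set x | forall f, f \in L -> dotp f x <= 1].

(** On the polar side, z shows that no inequality f.x <= 1 is redundant; on the
    primal side, that each f is a vertex of the hull of L.  Normalising the value
    at f to 1 makes z itself a point of the facet of f. *)
Definition exposed L : Prop := forall f, f \in L ->
  exists z, dotp f z = 1 /\ forall g, g \in L -> g != f -> dotp g z < 1.

Lemma card_fset_set_map (T U : choiceType) (h : T -> U) (s : seq T) :
    uniq s -> {in s &, injective h} ->
  #|` fset_set [set h i | i in [set` s]]| = size s.
Proof.
move=> us hs.
have -> : [set h i | i in [set` s]] = [set` [fset y in map h s]%fset].
  apply/seteqP; split=> [_ [i /= si <-]|y /=].
    by rewrite inE /= map_f.
  by rewrite inE /= => /mapP[i si ->]; exists i.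
by rewrite set_fsetK card_fseq undup_id ?size_map // map_inj_in_uniq.
Qed.

Lemma f_num_vertices P V : uniq V -> P = conv_hull [set` V] ->
    (forall v, v \in V ->
       exists c, forall w, w \in V -> w != v -> dotp c w < dotp c v) ->
  f_num 0 P = size V.
Proof.
move=> uV PE expV; rewrite /f_num -(card_fset_set_map (h := set1) uV); last first.
  by move=> v w _ _ /seteqP[/(_ v erefl)].
congr (#|` fset_set _|); apply/seteqP; split=> [F /= [[c [delta [cP FE]]]]|].
  move=> /has_dim0P[x Fx]; exists x => //=; apply: contrapT => xV.
  have [Px /= cx] : (P `&` [set y | dotp c y = delta]) x by rewrite -FE Fx.
  rewrite PE in Px.
  apply: (conv_hull_face (K := set0) _ _ _ Px cx) => [|v Vv|v Vv cv].
  - by apply/convexP.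
  - by apply/cP; rewrite PE; apply: conv_hull_sub.
  - suff Fv : F v by apply: xV; rewrite Fx in Fv; rewrite -[x]Fv.
    by rewrite FE; split=> //; rewrite PE; apply: conv_hull_sub.
move=> _ [v /= Vv <-]; split; last by apply/has_dim0P; exists v.
have [c cV] := expV _ Vv; exists c, (dotp c v).
have cVle w : w \in V -> dotp c w <= dotp c v.
  by move=> Vw; have [->//|/cV/ltW->] := eqVneq w v.
split=> [x|]; first by rewrite PE => /conv_hull_le; apply.
apply/seteqP; split=> [_ -> /=|x [/= Px cx]].
  by split=> //; rewrite PE; apply: conv_hull_sub.
rewrite PE in Px.
apply: (conv_hull_face (K := [set v]) _ cVle _ Px cx) => [|w Vw cw].
  by apply/convexP => _ _ t -> -> _ /=; rewrite -scalerDl addrC subrK scale1r.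
by apply/eqP; apply: contraPT cw => /(cV _ Vw) cw; apply/eqP; rewrite lt_eqF.
Qed.

(** A tight constraint that does not increase along u allows any step; each of the
    finitely many slack ones allows a small step. *)
Lemma halfspaces_step L x u :
    (forall f, f \in L -> dotp f x < 1 \/ dotp f x <= 1 /\ dotp f u <= 0) ->
  exists2 e : R, 0 < e & halfspaces L (x + e *: u).
Proof.
move=> Lx; suff [e e0 eP] : exists2 e : R, 0 < e &
    forall t, 0 <= t <= e -> halfspaces L (x + t *: u).
  by exists e => //; apply: eP; rewrite lexx ltW.
elim: L Lx => [_|f L IH Lx]; first by exists 1.
have [|e e0 eP] := IH; first by move=> g Lg; apply: Lx; rewrite inE Lg orbT.
have fP : exists2 e1 : R, 0 < e1 &
    forall t, 0 <= t <= e1 -> dotp f (x + t *: u) <= 1.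
  have [fx|[fx fu]] := Lx f (mem_head _ _); last first.
    by exists 1 => // t /andP[t0 t1]; rewrite dotpDr dotpZr; nra.
  have d0 : 0 < 1 + `|dotp f u| by rewrite ltr_pwDl.
  exists ((1 - dotp f x) / (1 + `|dotp f u|)); first by rewrite divr_gt0 ?subr_gt0.
  move=> t /andP[t0]; rewrite ler_pdivlMr // dotpDr dotpZr => tf.
  have := ler_norm (dotp f u); nra.
case: fP => e1 e10 e1P; exists (Num.min e e1); first by rewrite lt_min e0.
move=> t; rewrite le_min => /and3P[t0 te te1] g; rewrite inE => /predU1P[->|Lg].
  by apply: e1P; rewrite t0.
by apply: eP => //; rewrite t0.
Qed.

(** A set that contains a small step in every direction of a subspace, and no
    other directions, has the dimension of the subspace. *)
Lemma has_dim_local A a m (K : 'M[R]_(m, N)) : A a ->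
    (forall u, (u <= K)%MS -> exists2 e : R, 0 < e & A (a + e *: u)) ->
    (forall x, A x -> (x - a <= K)%MS) ->
  has_dim A (\rank K).
Proof.
move=> Aa KA AK.
have /choice[e eP] (i : 'I_m) : exists e : R, e != 0 /\ A (a + e *: row i K).
  by have [e e0 Ae] := KA _ (row_sub i K); exists e; rewrite gt_eqF.
pose W := \matrix_i (e i *: row i K).
have WK : (W :=: K)%MS.
  apply/eqmxP/andP; split; apply/row_subP => i.
    by rewrite rowK scalemx_sub // row_sub.
  have -> : row i K = (e i)^-1 *: row i W.
    by rewrite rowK scalerA mulVf ?scale1r //; case: (eP i).
  by rewrite scalemx_sub // row_sub.
rewrite -WK; apply/(@has_dim_spans_at _ _ _ a _ W) => //; split=> // [i|x Ax].
  by rewrite rowK; case: (eP i).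
by rewrite WK AK.
Qed.

Lemma halfspaces0 L : halfspaces L 0.
Proof. by move=> f _; rewrite dotp0r. Qed.

Lemma has_dim_halfspaces L : has_dim (halfspaces L) N.
Proof.
suff : has_dim (halfspaces L) (\rank (1%:M : 'M[R]_N)) by rewrite mxrank1.
apply: (@has_dim_local _ 0).
- exact: halfspaces0.
- move=> u _; apply: halfspaces_step => f _.
  by left; rewrite dotp0r.
- by move=> x _; rewrite submx1.
Qed.

(** Midpoints combine the slack of two points. *)
Lemma convex_strict A L : convex_set A -> A !=set0 ->
    (forall f, f \in L -> (forall x, A x -> dotp f x <= 1) /\
                          exists2 x, A x & dotp f x < 1) ->
  exists2 x, A x & forall f, f \in L -> dotp f x < 1.
Proof.
move=> /convexP cA [a Aa]; elim: L => [|f L IH] LA; first by exists a.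
have [g Lg|x Ax Lx] := IH; first by apply: LA; rewrite inE Lg orbT.
have [fA [y Ay fy]] := LA f (mem_head _ _).
exists (2^-1 *: x + (1 - 2^-1) *: y); first by apply: cA => //; lra.
move=> g; rewrite dotpDr !dotpZr inE => /predU1P[->|Lg].
  by have := fA _ Ax; lra.
have [gA _] := LA g (mem_behead (s := f :: L) Lg).
by have := gA _ Ay; have := Lx _ Lg; lra.
Qed.

Lemma has_dim_facet L f z : dotp f z = 1 ->
    (forall g, g \in L -> g != f -> dotp g z < 1) ->
  has_dim (halfspaces L `&` [set x | dotp f x = 1]) (N - 1).
Proof.
move=> fz Lz.
have kerE u : (u <= kermx f^T)%MS = (dotp f u == 0).
  rewrite dotpC dotpE; apply/sub_kermxP/eqP => [->|u0]; first by rewrite mxE.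
  by apply/matrixP => i j; rewrite !ord1 [RHS]mxE.
have f0 : f != 0.
  by apply: contra_eq_neq fz => ->; rewrite dotp0l eq_sym oner_eq0.
have rK : \rank (kermx f^T) = (N - 1)%N by rewrite mxrank_ker mxrank_tr rank_rV f0.
rewrite -rK; apply: (@has_dim_local _ z).
- split=> // g Lg; have [->|gf] := eqVneq g f; first by rewrite fz.
  by apply/ltW/Lz.
- move=> u; rewrite kerE => /eqP fu.
  have [g Lg|e e0 eP] := @halfspaces_step L z u.
    have [->|gf] := eqVneq g f; first by right; rewrite fz fu.
    by left; apply: Lz.
  by exists e => //; split=> //=; rewrite dotpDr dotpZr fu mulr0 addr0.
- by move=> x [_ /= fx]; rewrite kerE dotpBr fx fz subrr.
Qed.

(** If a face of dimension N - 1 lies in no facet {f.x = 1}, then by convexity it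
    contains a point where all inequalities are strict.  A linear functional with
    a maximum at such an interior point is zero, so the face is the whole
    polytope, which has dimension N. *)
Lemma f_num_facets L : (0 < N)%N -> uniq L -> exposed L ->
  f_num (N - 1) (halfspaces L) = size L.
Proof.
move=> N0 uL expL; pose facet f := halfspaces L `&` [set x | dotp f x = 1].
rewrite /f_num -(card_fset_set_map (h := facet) uL); last first.
  move=> f g Lf Lg fg; apply: contrapT => /eqP; rewrite eq_sym => gf.
  have [z [fz Lz]] := expL _ Lf.
  have : facet f z.
    split=> // h Lh; have [->|hf] := eqVneq h f; first by rewrite fz.
    by apply/ltW/Lz.
  by rewrite fg => -[_ /= gz]; have := Lz _ Lg gf; rewrite gz ltxx.
have facetP f : f \in L -> face (halfspaces L) (facet f).
  by move=> Lf; exists f, 1; split=> // x; apply.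
have facet_dim f : f \in L -> has_dim (facet f) (N - 1).
  by move=> /expL[z [fz Lz]]; apply: has_dim_facet fz Lz.
congr (#|` fset_set _|); apply/seteqP.
split=> [F /= [FP Fd]|_ [f Lf <-]]; last first.
  by split; [apply: facetP | apply: facet_dim].
apply: contrapT => notF.
have FsubP : F `<=` halfspaces L by case: FP => c [delta [_ ->]] x [].
have [a Fa] := has_dim_neq0 Fd.
have [||f Lf|x Fx Lx] := @convex_strict F L.
- apply/convexP => x y t; case: FP => c [delta [_ ->]].
  move=> [Lx /= cx] [Ly /= cy] /andP[t0 t1].
  split=> [f Lf|/=]; rewrite dotpDr !dotpZr ?cx ?cy; last by ring.
  by have := Lx _ Lf; have := Ly _ Lf; nra.
- by exists a.
- split=> [x /FsubP|]; first exact.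
  apply: contrapT => Ff; apply: notF; exists f => //; apply/esym.
  apply: face_eq_of_dim FP _ _ Fd (facet_dim _ Lf) => [x Fx|x []//].
  split; first exact: FsubP.
  apply/eqP; rewrite eq_le FsubP //= leNgt; apply/negP => fx.
  by apply: Ff; exists x.
have : F = halfspaces L.
  case: FP => c [delta [cP FE]].
  have [Px /= cx] : (halfspaces L `&` [set x | dotp c x = delta]) x by rewrite -FE.
  have [f Lf|e e0 eP] := @halfspaces_step L x c; first by left; apply: Lx.
  have c0 : c = 0.
    apply/eqP; apply: contraT => /dotp_gt0 cc.
    by have := cP _ eP; rewrite dotpDr dotpZr cx; nra.
  rewrite FE; apply/seteqP; split=> [y []//|y Py]; split=> //=.
  by rewrite -cx c0 !dotp0l.
move=> FE; rewrite FE in Fd; have := has_dim_inj Fd (has_dim_halfspaces L).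
by move/eqP; rewrite ltn_eqF // ltn_subrL N0.
Qed.

End Counting.
(** * Vertices and facet normals of Hanner polytopes *)

Section DualPairs.
Local Open Scope classical_set_scope.
Local Open Scope ring_scope.
Variable R : realType.
Implicit Types (m n N : nat).

(** Both descriptions of P and of its polar are kept: the symmetric form makes
    polarity the exchange of V and F, and gives the bipolar theorem for P without
    a separation argument. *)
Record dual_pair N (P : set 'rV[R]_N) (V F : seq 'rV[R]_N) : Prop := DualPair {
  dual_uniqV : uniq V;
  dual_uniqF : uniq F;
  dual_expV : exposed V;
  dual_expF : exposed F;
  dual_conv : P = conv_hull [set` V];
  dual_half : P = halfspaces F;
  dual_polar : conv_hull [set` F] = halfspaces V }.

Lemma polar_conv_hull N (V : seq 'rV[R]_N) :
  polar (conv_hull [set` V]) = halfspaces V.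
Proof.
apply/seteqP; split=> y yV v Vv; first by apply: yV; apply: conv_hull_sub.
by rewrite dotpC; apply: (conv_hull_le Vv) => w Vw; rewrite dotpC; apply: yV.
Qed.

Lemma dual_pair_polar N (P : set 'rV[R]_N) V F :
  dual_pair P V F -> dual_pair (polar P) F V.
Proof.
move=> [uV uF eV eF PV PF FV].
split=> //; last by rewrite -PV.
  by rewrite PV polar_conv_hull FV.
by rewrite PV polar_conv_hull.
Qed.

Lemma dual_pair_polarK N (P : set 'rV[R]_N) V F :
  dual_pair P V F -> polar (polar P) = P.
Proof.
move=> PVF; have [_ _ _ _ PV _ _] := dual_pair_polar PVF.
by rewrite PV polar_conv_hull -(dual_half PVF).
Qed.

Lemma f_num_dual_pair N (P : set 'rV[R]_N) V F : (0 < N)%N ->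
  dual_pair P V F -> f_num 0 P = size V /\ f_num (N - 1) P = size F.
Proof.
move=> N0 [uV uF eV eF PV PF FV]; split; last by rewrite PF f_num_facets.
apply: f_num_vertices => // v /eV[z [vz Vz]]; exists z => w Vw wv.
by rewrite dotpC [ltRHS]dotpC vz Vz.
Qed.

Lemma has_dim_dual_pair N (P : set 'rV[R]_N) V F : dual_pair P V F -> has_dim P N.
Proof. by move=> /dual_half ->; apply: has_dim_halfspaces. Qed.

(** The gauge of the polar of P at y is the maximum of v.y over V.  When this
    maximum is 0, a small multiple of y lies in P, whence y.y <= 0. *)
Lemma dual_pair_scale N (P : set 'rV[R]_N) V F y (M : R) :
    dual_pair P V F -> 0 <= M -> (forall v, v \in V -> dotp v y <= M) ->
  exists2 z, conv_hull [set` F] z & y = M *: z.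
Proof.
move=> [_ _ _ _ PV PF FV]; rewrite le_eqVlt => /predU1P[<-|M0] yV; last first.
  exists (M^-1 *: y); last by rewrite scalerA divff ?scale1r ?gt_eqF.
  by rewrite FV => v Vv; rewrite dotpZr mulrC ler_pdivrMr ?mul1r ?yV.
exists 0; first by rewrite FV; apply: halfspaces0.
have [f _|e e0] := @halfspaces_step R N F 0 y; first by left; rewrite dotp0r.
rewrite -PF PV add0r => ey.
have : dotp y (e *: y) <= 0 
  by apply: (conv_hull_le ey) => v Vv; rewrite dotpC; apply: yV.
rewrite dotpZr pmulr_rle0 // => yy; rewrite scale0r; apply/eqP.
by apply: contraT => /dotp_gt0; rewrite ltNge yy.
Qed.

(** The maximum is nonnegative because 0 lies in the hull of V. *)
Lemma dual_pair_max N (P : set 'rV[R]_N) V F y : dual_pair P V F ->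
  exists v, [/\ v \in V, 0 <= dotp v y & forall w, w \in V -> dotp w y <= dotp v y].
Proof.
move=> PVF.
have P0 : P 0 by rewrite (dual_half PVF); apply: halfspaces0.
have [v Vv vmax] : exists2 v, v \in V & forall w, w \in V -> dotp w y <= dotp v y.
  have : V != [::].
    apply/eqP => V0; move: P0; rewrite (dual_conv PVF) V0 => V00.
    suff : set0 (0 : 'rV[R]_N) by [].
    by apply: (conv_hull_ind V00).
  elim: V {PVF} => // v V IH _; have [->|/IH[w Vw wmax]] := eqVneq V [::].
    by exists v => [|w]; rewrite inE // => /eqP ->.
  have [vw|/ltW wv] := leP (dotp v y) (dotp w y).
    exists w; first by rewrite inE Vw orbT.
    by move=> u; rewrite inE => /predU1P[->//|/wmax].
  exists v; first by rewrite mem_head.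
  by move=> u; rewrite inE => /predU1P[->//|/wmax/le_trans->].
exists v; split=> //; move: P0; rewrite (dual_conv PVF) -(dotp0r y) => V0.
by apply: (conv_hull_le V0) => w Vw; rewrite dotpC; apply: vmax.
Qed.

Definition seq_prod m n (V : seq 'rV[R]_m) (W : seq 'rV[R]_n) :
    seq 'rV[R]_(m + n) :=
  [seq row_mx v w | v <- V, w <- W].

Definition seq_sum m n (F : seq 'rV[R]_m) (G : seq 'rV[R]_n) :
    seq 'rV[R]_(m + n) :=
  [seq row_mx f 0 | f <- F] ++ [seq row_mx 0 g | g <- G].

Lemma size_seq_prod m n (V : seq 'rV[R]_m) (W : seq 'rV[R]_n) :
  size (seq_prod V W) = (size V * size W)%N.
Proof. exact: size_allpairs. Qed.

Lemma size_seq_sum m n (F : seq 'rV[R]_m) (G : seq 'rV[R]_n) :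
  size (seq_sum F G) = (size F + size G)%N.
Proof. by rewrite size_cat !size_map. Qed.

Lemma mem_seq_sum m n (F : seq 'rV[R]_m) (G : seq 'rV[R]_n) (h : 'rV[R]_(m + n)) :
  h \in seq_sum F G <-> (exists2 f, f \in F & h = row_mx f 0) \/
                        (exists2 g, g \in G & h = row_mx 0 g).
Proof.
rewrite mem_cat; split=> [/orP[] /mapP|].
- by left.
- by right.
- by case=> [[f Ff ->]|[g Gg ->]]; apply/orP; [left|right];
     apply/mapP; [exists f | exists g].
Qed.

Lemma exposed_neq0 N (F : seq 'rV[R]_N) f : exposed F -> f \in F -> f != 0.
Proof.
move=> eF /eF[z [fz _]].
by apply: contra_eq_neq fz => ->; rewrite dotp0l eq_sym oner_eq0.
Qed.

Lemma uniq_seq_prod m n (V : seq 'rV[R]_m) (W : seq 'rV[R]_n) :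
  uniq V -> uniq W -> uniq (seq_prod V W).
Proof.
move=> uV uW; apply: allpairs_uniq => // -[v w] [v' w'] _ _ /=.
by move=> /eq_row_mx[-> ->].
Qed.

Lemma uniq_seq_sum m n (F : seq 'rV[R]_m) (G : seq 'rV[R]_n) :
  exposed F -> uniq F -> uniq G -> uniq (seq_sum F G).
Proof.
move=> eF uF uG; rewrite cat_uniq !map_inj_uniq ?uF ?uG ?andbT /=.
- apply/hasPn => _ /mapP[g Gg ->]; apply/mapP => -[f Ff /eq_row_mx[f0 _]].
  by have := exposed_neq0 eF Ff; rewrite -f0 eqxx.
- by move=> g h /eq_row_mx[].
- by move=> g h /eq_row_mx[].
Qed.

Lemma exposed_prod m n (V : seq 'rV[R]_m) (W : seq 'rV[R]_n) :
  exposed V -> exposed W -> exposed (seq_prod V W).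
Proof.
move=> eV eW _ /allpairsP[[v w] [/= Vv Ww ->]].
have [y [vy Vy]] := eV _ Vv; have [z [wz Wz]] := eW _ Ww.
exists (2^-1 *: row_mx y z); split.
  by rewrite dotpZr dotp_row_mx vy wz; lra.
move=> _ /allpairsP[[v' w'] [/= Vv' Ww' ->]] neq.
rewrite dotpZr dotp_row_mx.
have [v'E|/(Vy _ Vv') ltv] := eqVneq v' v;
  have [w'E|/(Wz _ Ww') ltw] := eqVneq w' w.
- by rewrite v'E w'E eqxx in neq.
- by rewrite v'E vy; lra.
- by rewrite w'E wz; lra.
- by lra.
Qed.

Lemma exposed_sum m n (F : seq 'rV[R]_m) (G : seq 'rV[R]_n) :
  exposed F -> exposed G -> exposed (seq_sum F G).
Proof.
move=> eF eG h /mem_seq_sum[[f Ff ->]|[g Gg ->]].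
  have [y [fy Fy]] := eF _ Ff; exists (row_mx y 0); split.
    by rewrite dotp_row_mx fy dotp0r addr0.
  move=> _ /mem_seq_sum[[f' Ff' ->]|[g' Gg' ->]] neq.
    rewrite dotp_row_mx dotp0r addr0 Fy //.
    by apply: contra_neq neq => ->.
  by rewrite dotp_row_mx dotp0r addr0 dotp0l ltr01.
have [y [gy Gy]] := eG _ Gg; exists (row_mx 0 y); split.
  by rewrite dotp_row_mx gy dotp0r add0r.
move=> _ /mem_seq_sum[[f' Ff' ->]|[g' Gg' ->]] neq.
  by rewrite dotp_row_mx dotp0r add0r dotp0l ltr01.
rewrite dotp_row_mx dotp0r add0r Gy //.
by apply: contra_neq neq => ->.
Qed.

Lemma cartesianP m n (P : set 'rV[R]_m) (Q : set 'rV[R]_n) x y :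
  cartesian P Q (row_mx x y) <-> P x /\ Q y.
Proof.
split=> [[x' Px' [y' Qy' /eq_row_mx[<- <-]]]//|[Px Qy]].
by exists x => //; exists y.
Qed.

Lemma row_mx_conv m n (x x' : 'rV[R]_m) (y y' : 'rV[R]_n) t :
  t *: row_mx x y + (1 - t) *: row_mx x' y' =
  row_mx (t *: x + (1 - t) *: x') (t *: y + (1 - t) *: y').
Proof. by rewrite !scale_row_mx add_row_mx. Qed.

(** Convexity in one block at a time. *)
Lemma conv_hull_prod m n (V : seq 'rV[R]_m) (W : seq 'rV[R]_n) :
  conv_hull [set` seq_prod V W] =
  cartesian (conv_hull [set` V]) (conv_hull [set` W]).
Proof.
have cV := conv_hull_convex (A := [set` V]).
have cW := conv_hull_convex (A := [set` W]).
have cVW := conv_hull_convex (A := [set` seq_prod V W]).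
move/convexP: cV => cV; move/convexP: cW => cW; move/convexP: cVW => cVW.
apply/seteqP; split=> [p Vp|_ [x Vx [y Wy <-]]].
  apply: (conv_hull_ind Vp) => [q r t|_ /allpairsP[[v w] [/= Vv Ww ->]]].
    rewrite -(hsubmxK q) -(hsubmxK r) row_mx_conv.
    move=> /cartesianP[q1 q2] /cartesianP[r1 r2] t01.
    by apply/cartesianP; split; [apply: cV | apply: cW].
  by apply/cartesianP; split; apply: conv_hull_sub.
pose K x := conv_hull [set` seq_prod V W] (row_mx x y).
apply: (@conv_hull_ind _ _ _ K _ Vx) => {x Vx} [x x' t Kx Kx' t01|v Vv].
  have := cVW _ _ _ Kx Kx' t01; rewrite row_mx_conv /K.
  by rewrite -[t *: y + _]scalerDl subrKC scale1r.
pose K' y := conv_hull [set` seq_prod V W] (row_mx v y).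
apply: (@conv_hull_ind _ _ _ K' _ Wy) => {K y Wy} [y y' t Ky Ky' t01|w Ww].
  have := cVW _ _ _ Ky Ky' t01; rewrite row_mx_conv /K'.
  by rewrite -[t *: v + _]scalerDl subrKC scale1r.
by apply: conv_hull_sub; apply/allpairsP; exists (v, w).
Qed.

Lemma halfspaces_sum m n (F : seq 'rV[R]_m) (G : seq 'rV[R]_n) :
  halfspaces (seq_sum F G) = cartesian (halfspaces F) (halfspaces G).
Proof.
apply/seteqP; split=> p; rewrite -(hsubmxK p).
  move=> pFG; apply/cartesianP; split=> [f Ff|g Gg].
    have /pFG : row_mx f 0 \in seq_sum F G by apply/mem_seq_sum; left; exists f.
    by rewrite dotp_row_mx dotp0l addr0.
  have /pFG : row_mx 0 g \in seq_sum F G by apply/mem_seq_sum; right; exists g.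
  by rewrite dotp_row_mx dotp0l add0r.
move=> /cartesianP[pF pG] _ /mem_seq_sum[[f Ff ->]|[g Gg ->]].
  by rewrite dotp_row_mx dotp0l addr0 pF.
by rewrite dotp_row_mx dotp0l add0r pG.
Qed.

Lemma convex_sub_sum N (K : set 'rV[R]_N) (a b : R) x y : convex_set K -> K 0 ->
  K x -> K y -> 0 <= a -> 0 <= b -> a + b <= 1 -> K (a *: x + b *: y).
Proof.
move=> /convexP cK K0 Kx Ky a0 b0 ab.
have [ab0|abn0] := eqVneq (a + b) 0.
  have [-> ->] : a = 0 /\ b = 0 by split; lra.
  by rewrite !scale0r addr0.
have ab_gt0 : 0 < a + b by rewrite lt_neqAle eq_sym abn0 addr_ge0.
have -> : a *: x + b *: y =
    (a + b) *: ((a / (a + b)) *: x + (1 - a / (a + b)) *: y) + (1 - (a + b)) *: 0.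
  by apply/rowP => i; rewrite !mxE; field.
apply: (cK) => //; last by rewrite ltW.
apply: cK => //; apply/andP; split; first by rewrite divr_ge0 // ltW.
by rewrite ler_pdivrMr // mul1r; lra.
Qed.

Lemma conv_hull_linear m n (A : 'M[R]_(m, n)) (V : set 'rV[R]_m)
    (W : set 'rV[R]_n) x :
    conv_hull V x -> (forall v, V v -> W (v *m A)) -> conv_hull W (x *m A).
Proof.
move=> Vx VW; pose K x := conv_hull W (x *m A).
apply: (@conv_hull_ind _ _ _ K _ Vx) => {x Vx} [x y t Kx Ky t01|v Vv].
  rewrite /K mulmxDl -!scalemxAl.
  by move/convexP: (@conv_hull_convex _ _ W); apply.
by apply: conv_hull_sub; apply: VW.
Qed.

(** The inclusion with content is that the polar of the product lies in the hull of
    the polars of its factors.  If y = (y1, y2) is bounded by 1 on V x W, the maxima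
    a of y1 on V and b of y2 on W satisfy a + b <= 1, and y = a (z1, 0) + b (0, z2)
    with z1, z2 in the polars of the factors. *)
Lemma dual_pair_prod m n (P : set 'rV[R]_m) V F (Q : set 'rV[R]_n) W G :
    dual_pair P V F -> dual_pair Q W G ->
  dual_pair (cartesian P Q) (seq_prod V W) (seq_sum F G).
Proof.
move=> PVF QWG.
have [uV uF eV eF PV PF FV] := PVF; have [uW uG eW eG QW QG GW] := QWG.
split.
- exact: uniq_seq_prod.
- exact: uniq_seq_sum.
- exact: exposed_prod.
- exact: exposed_sum.
- by rewrite conv_hull_prod PV QW.
- by rewrite halfspaces_sum PF QG.
have VFle v f : v \in V -> f \in F -> dotp v f <= 1.
  move=> Vv Ff; rewrite dotpC; move: f Ff; apply/(_ : halfspaces F v).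
  by rewrite -PF PV; apply: conv_hull_sub.
have WGle v f : v \in W -> f \in G -> dotp v f <= 1.
  move=> Vv Ff; rewrite dotpC; move: f Ff; apply/(_ : halfspaces G v).
  by rewrite -QG QW; apply: conv_hull_sub.
apply/seteqP; split=> y.
  move=> FGy _ /allpairsP[[v w] [/= Vv Ww ->]]; apply: (conv_hull_le FGy).
  move=> h /mem_seq_sum[[f Ff ->]|[g Gg ->]]; rewrite dotp_row_mx dotp0r.
    by rewrite addr0 VFle.
  by rewrite add0r WGle.
rewrite -(hsubmxK y); set y1 := lsubmx y; set y2 := rsubmx y => VWy.
have [v [Vv v0 vmax]] := dual_pair_max y1 PVF.
have [w [Ww w0 wmax]] := dual_pair_max y2 QWG.
have [z1 Fz1 ->] := dual_pair_scale PVF v0 vmax.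
have [z2 Gz2 ->] := dual_pair_scale QWG w0 wmax.
have FGl z : conv_hull [set` F] z -> conv_hull [set` seq_sum F G] (row_mx z 0).
  move=> Fz; have -> : row_mx z 0 = z *m row_mx 1%:M (0 : 'M[R]_(m, n)).
    by rewrite mul_mx_row mulmx1 mulmx0.
  apply: (conv_hull_linear Fz) => f Ff; apply/mem_seq_sum; left; exists f => //.
  by rewrite mul_mx_row mulmx1 mulmx0.
have FGr z : conv_hull [set` G] z -> conv_hull [set` seq_sum F G] (row_mx 0 z).
  move=> Gz; have -> : row_mx 0 z = z *m row_mx (0 : 'M[R]_(n, m)) 1%:M.
    by rewrite mul_mx_row mulmx1 mulmx0.
  apply: (conv_hull_linear Gz) => g Gg; apply/mem_seq_sum; right; exists g => //.
  by rewrite mul_mx_row mulmx1 mulmx0.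
have -> : row_mx (dotp v y1 *: z1) (dotp w y2 *: z2) =
    dotp v y1 *: row_mx z1 0 + dotp w y2 *: row_mx 0 z2.
  by rewrite !scale_row_mx add_row_mx !scaler0 addr0 add0r.
apply: convex_sub_sum => //; [exact: conv_hull_convex | | exact: FGl | exact: FGr |].
  by rewrite -row_mx0; apply: FGl; rewrite FV; apply: halfspaces0.
rewrite -dotp_row_mx; apply: VWy; apply/allpairsP; by exists (v, w).
Qed.

Definition segment_ends : seq 'rV[R]_1 := [:: const_mx 1; const_mx (-1)].

Lemma cube1P (x : 'rV[R]_1) : cube x <-> -1 <= x 0 0 <= 1.
Proof. by split=> [|x1 i]; [apply | rewrite ord1]. Qed.

Lemma dotp1 (x y : 'rV[R]_1) : dotp x y = x 0 0 * y 0 0.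
Proof. by rewrite /dotp big_ord1. Qed.

Lemma dual_pair_segment : dual_pair (@cube R 1) segment_ends segment_ends.
Proof.
have cube1E : @cube R 1 = halfspaces segment_ends.
  apply/seteqP; split=> [x /cube1P x1 f|x x1].
    by rewrite !inE => /orP[] /eqP->; rewrite dotp1 !mxE /=; lra.
  apply/cube1P; have := x1 (const_mx 1); have := x1 (const_mx (-1)).
  rewrite !inE !eqxx orbT /=.
  by move=> /(_ erefl) + /(_ erefl); rewrite !dotp1 !mxE /=; lra.
have neq : (const_mx 1 : 'rV[R]_1) != const_mx (-1).
  by apply/eqP => /rowP/(_ 0); rewrite !mxE /=; lra.
have exp1 : exposed segment_ends.
  move=> f; rewrite !inE => /orP[]/eqP->;
    [exists (const_mx 1) | exists (const_mx (-1))]; split.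
  - by rewrite dotp1 !mxE; lra.
  - by move=> g; rewrite !inE => /orP[]/eqP->; rewrite ?eqxx // dotp1 !mxE /=; lra.
  - by rewrite dotp1 !mxE /=; lra.
  - by move=> g; rewrite !inE => /orP[]/eqP->; rewrite ?eqxx // dotp1 !mxE /=; lra.
have cube1V : @cube R 1 = conv_hull [set` segment_ends].
  apply/seteqP; split=> x.
    move=> /cube1P /andP[x1 x2].
    pose t : R := (1 + x 0 0) / 2.
    have -> : x = t *: const_mx 1 + (1 - t) *: const_mx (-1) :> 'rV[R]_1.
      by apply/rowP => i; rewrite ord1 !mxE /t; lra.
    move/convexP: (@conv_hull_convex _ _ [set` segment_ends]); apply;
      last by rewrite /t; lra.
      by apply: conv_hull_sub; rewrite /= !inE eqxx.
    by apply: conv_hull_sub; rewrite /= !inE eqxx orbT.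
  move=> Vx; apply: (conv_hull_ind Vx) => {x Vx} [x y t|v /=].
    by move=> /cube1P x1 /cube1P y1 t01; apply/cube1P; rewrite !mxE; nra.
  by rewrite !inE => /orP[]/eqP->; apply/cube1P; rewrite !mxE /=; lra.
by split; rewrite // /segment_ends ?cube1V -?cube1E //= inE neq.
Qed.

End DualPairs.
(** * Extremal counts of Hanner polytopes *)

Section HannerCounts.
Local Open Scope classical_set_scope.
Local Open Scope ring_scope.
Variable R : realType.
Implicit Types (m n N d : nat).

Definition linearly_isomorphic N (P Q : set 'rV[R]_N) : Prop :=
  exists2 A : 'M[R]_N, A \in unitmx & forall x, P x <-> Q (x *m A).

Lemma linearly_isomorphic_sym N (P Q : set 'rV[R]_N) :
  linearly_isomorphic P Q -> linearly_isomorphic Q P.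
Proof.
move=> [A Au PQ]; exists (invmx A); rewrite ?unitmx_inv // => x.
by rewrite PQ mulmxKV.
Qed.

Lemma linearly_isomorphic_trans N (P Q S : set 'rV[R]_N) :
  linearly_isomorphic P Q -> linearly_isomorphic Q S -> linearly_isomorphic P S.
Proof.
move=> [A Au PQ] [B Bu QS]; exists (A *m B); first by rewrite unitmx_mul Au.
by move=> x; rewrite PQ QS mulmxA.
Qed.

Lemma linearly_isomorphic_polar N (P Q : set 'rV[R]_N) :
  linearly_isomorphic P Q -> linearly_isomorphic (polar P) (polar Q).
Proof.
move=> [A Au PQ]; exists (invmx A)^T; first by rewrite unitmx_tr unitmx_inv.
move=> y; split=> [Py z Qz|Qy x Px].
  by rewrite dotp_mulmx trmxK; apply: Py; rewrite PQ mulmxKV.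
have := Qy _ (iffLR (PQ x) Px).
by rewrite dotp_mulmx trmxK mulmxK.
Qed.

Lemma linearly_isomorphic_cartesian m n (P P' : set 'rV[R]_m)
    (Q Q' : set 'rV[R]_n) :
    linearly_isomorphic P P' -> linearly_isomorphic Q Q' ->
  linearly_isomorphic (cartesian P Q) (cartesian P' Q').
Proof.
move=> [A Au PP'] [B Bu QQ']; exists (block_mx A 0 0 B).
  by rewrite unitmxE det_ublock unitrM -!unitmxE Au.
move=> x; rewrite -(hsubmxK x) mul_row_block !mulmx0 addr0 add0r !cartesianP.
by rewrite PP' QQ'.
Qed.

Lemma linearly_isomorphic_affinely N (P Q : set 'rV[R]_N) :
  linearly_isomorphic P Q -> affinely_isomorphic P Q.
Proof.
move=> [A Au PQ]; exists A, 0; split.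
- by move=> x /PQ; rewrite addr0.
- by move=> x y _ _; rewrite !addr0 => /(can_inj (mulmxK Au)).
- by move=> y Qy; exists (y *m invmx A); rewrite /= ?addr0 ?PQ mulmxKV.
Qed.

Lemma cube_cartesian m n : @cube R (m + n) = cartesian (@cube R m) (@cube R n).
Proof.
apply/seteqP; split=> x; rewrite -(hsubmxK x).
  move=> cx; apply/cartesianP; split=> i.
    by have := cx (lshift n i); rewrite row_mxEl.
  by have := cx (rshift m i); rewrite row_mxEr.
move=> /cartesianP[c1 c2] i; case: (split_ordP i) => j ->.
  by rewrite row_mxEl.
by rewrite row_mxEr.
Qed.

Lemma dual_pair_cube d : (0 < d)%N ->
  exists V F, [/\ dual_pair (@cube R d) V F, size V = (2 ^ d)%N
    & size F = (2 * d)%N].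
Proof.
case: d => // d _; elim: d => [|d [V [F [VF sV sF]]]].
  by exists (segment_ends R), (segment_ends R); split=> //; apply: dual_pair_segment.
rewrite -[d.+2]/(1 + d.+1)%N cube_cartesian expnD mulnDr.
exists (seq_prod (segment_ends R) V), (seq_sum (segment_ends R) F).
rewrite size_seq_prod size_seq_sum sV sF; split=> //.
by apply: dual_pair_prod VF; apply: dual_pair_segment.
Qed.

Lemma linearly_isomorphic_polar_cross N (P : set 'rV[R]_N) : (0 < N)%N ->
  linearly_isomorphic P (@cross_polytope R N) ->
  linearly_isomorphic (polar P) (@cube R N).
Proof.
move=> N0 /linearly_isomorphic_polar; have [V [F [VF _ _]]] := dual_pair_cube N0.
by rewrite /cross_polytope (dual_pair_polarK VF).
Qed.

(** The map (a, b) -> (a + b, a - b) turns |a| + |b| <= 1 into a square. *)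
Lemma square_cross :
  linearly_isomorphic (@cube R (1 + 1)) (@cross_polytope R (1 + 1)).
Proof.
apply: linearly_isomorphic_sym; pose B : 'M[R]_(1 + 1) := block_mx 1 1 1 (-1).
exists B.
  have /mulmx1_unit[] // : B *m (2^-1 *: B) = 1%:M.
  rewrite -scalemxAr /B mulmx_block !mul1mx !mulmx1 mulmxN mulmx1 opprK subrr.
  rewrite scale_block_mx scaler0 scalerDr -scalerDl (_ : 2^-1 + 2^-1 = 1); last by lra.
  by rewrite scale1r -scalar_mx_block.
move=> y; rewrite -(hsubmxK y) mul_row_block !mulmx1 mulmxN mulmx1.
set a := lsubmx y; set b := rsubmx y.
rewrite cube_cartesian cartesianP !cube1P /cross_polytope cube_cartesian.
rewrite (dual_conv (dual_pair_prod (dual_pair_segment R) (dual_pair_segment R))).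
rewrite polar_conv_hull !mxE; split=> [ab|ab _ /allpairsP[[v w] [/= Vv Ww ->]]].
  have le1 v w : v \in segment_ends R -> w \in segment_ends R ->
      v 0 0 * a 0 0 + w 0 0 * b 0 0 <= 1.
    move=> Vv Ww; rewrite -!dotp1 -dotp_row_mx; apply: ab.
    by apply/allpairsP; exists (v, w).
  have V1 : const_mx 1 \in segment_ends R by rewrite inE eqxx.
  have VN1 : const_mx (-1) \in segment_ends R by rewrite !inE eqxx orbT.
  have := (le1 _ _ V1 V1, le1 _ _ V1 VN1, le1 _ _ VN1 V1, le1 _ _ VN1 VN1).
  by rewrite !mxE => -[[[? ?] ?] ?]; split; lra.
rewrite dotp_row_mx !dotp1.
by move: Vv Ww; rewrite !inE => /orP[]/eqP-> /orP[]/eqP->; rewrite !mxE; lra.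
Qed.

(** The invariant carried through the construction of Hanner polytopes, with v and
    f the numbers of vertices and facets.  The bounds by 2 ^ N on v and f carry
    the bound on v * f over to products, and the implications from counts to
    linear type identify the polytope in the equality case. *)
Definition extremal_counts N (P : set 'rV[R]_N) (v f : nat) : Prop :=
  [/\ (0 < N /\ v <= 2 ^ N /\ f <= 2 ^ N)%N,
      (v * f <= N * 2 ^ (N + 1))%N,
      (v = 2 ^ N -> f = 2 * N -> linearly_isomorphic P (@cube R N))%N,
      (v = 2 * N -> f = 2 ^ N -> linearly_isomorphic P (@cross_polytope R N))%N
    & (v * f = N * 2 ^ (N + 1) ->
         (v = 2 ^ N /\ f = 2 * N) \/ (v = 2 * N /\ f = 2 ^ N))%N].

Lemma extremal_counts_segment : extremal_counts (@cube R 1) 2 2.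
Proof.
have idiso : linearly_isomorphic (@cube R 1) (@cube R 1).
  by exists 1%:M; rewrite ?unitmx1 // => x; rewrite mulmx1.
split=> // [_ _|_]; last by left.
exists 1%:M; rewrite ?unitmx1 // => x; rewrite mulmx1.
have seg := dual_pair_segment R.
by rewrite /cross_polytope {2}(dual_conv seg) polar_conv_hull -(dual_half seg).
Qed.

Lemma extremal_counts_polar N (P : set 'rV[R]_N) v f :
  extremal_counts P v f -> extremal_counts (polar P) f v.
Proof.
move=> [[N0 [vN fN]] vf cubeP crossP extP]; split=> //.
- by rewrite mulnC.
- by move=> fE vE; apply: linearly_isomorphic_polar_cross => //; apply: crossP.
- by move=> fE vE; apply: linearly_isomorphic_polar; apply: cubeP.
- by rewrite mulnC => /extP[[-> ->]|[-> ->]]; [right | left].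
Qed.

Lemma eq_of_mul_eq (a b v w : nat) : (0 < a)%N -> (0 < b)%N ->
  (v <= a)%N -> (w <= b)%N -> (v * w = a * b)%N -> v = a /\ w = b.
Proof.
move=> a0 b0 va wb vwE; split; apply/eqP; rewrite eqn_leq (va, wb) leqNgt.
  by apply/negP => v_lt; nia.
by apply/negP => w_lt; nia.
Qed.

Lemma eq2_of_mul_le_add (a b : nat) :
  (2 <= a)%N -> (2 <= b)%N -> (a * b <= a + b)%N -> a = 2%N.
Proof.
move=> a2 b2 ab; apply/eqP; rewrite eqn_leq a2 leqNgt andbT; apply/negP => a3.
have b3 : (3 * b <= a * b)%N by rewrite leq_mul2r a3 orbT.
have ba : (a * 2 <= a * b)%N by rewrite leq_mul2l b2 orbT.
lia.
Qed.

Lemma leq_of_mul_pow (a k v f : nat) : (0 < a)%N -> v = a ->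
  (v * f <= k * (2 * a))%N -> (f <= 2 * k)%N.
Proof. by move=> a0 -> vf; rewrite -(leq_pmul2l a0); lia. Qed.

(** A product can reach the counts of the cube only if both factors do.  It reaches
    those of the cross-polytope only if 2 ^ m + 2 ^ n >= 2 ^ (m + n), that is, if
    both factors are segments and the product is a square. *)
Lemma extremal_counts_cartesian m n (P : set 'rV[R]_m) (Q : set 'rV[R]_n) v f w g :
  extremal_counts P v f -> extremal_counts Q w g ->
  extremal_counts (cartesian P Q) (v * w) (f + g).
Proof.
move=> [[m0 [vm fm]] vf cubeP crossP extP] [[n0 [wn gn]] wg cubeQ crossQ extQ].
have m2 : (2 <= 2 ^ m)%N by rewrite -[leqLHS]expn1 leq_exp2l.
have n2 : (2 <= 2 ^ n)%N by rewrite -[leqLHS]expn1 leq_exp2l.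
have m_gt0 : (0 < 2 ^ m)%N by rewrite expn_gt0.
have n_gt0 : (0 < 2 ^ n)%N by rewrite expn_gt0.
rewrite !addn1 !expnS in vf wg extP extQ.
have vfw : (v * w * f <= m * 2 * (2 ^ m * 2 ^ n))%N by nia.
have wgv : (v * w * g <= n * 2 * (2 ^ m * 2 ^ n))%N by nia.
split.
- split; first by rewrite addn_gt0 m0.
  by rewrite expnD; split; nia.
- by rewrite addn1 expnS expnD; nia.
- rewrite expnD => vwE fgE.
  have [] := eq_of_mul_eq _ _ vm wn vwE => // vE wE.
  have f_le := leq_of_mul_pow m_gt0 vE vf.
  have g_le := leq_of_mul_pow n_gt0 wE wg.
  rewrite cube_cartesian; apply: linearly_isomorphic_cartesian.
    by apply: cubeP => //; lia.
  by apply: cubeQ => //; lia.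
- rewrite expnD => vwE fgE.
  have [m1 n1] : m = 1%N /\ n = 1%N.
    have ab : (2 ^ m * 2 ^ n <= 2 ^ m + 2 ^ n)%N by rewrite -fgE leq_add.
    have a2 : (2 ^ m = 2 ^ 1)%N by apply: eq2_of_mul_le_add m2 n2 ab.
    have b2 : (2 ^ n = 2 ^ 1)%N.
      by apply: eq2_of_mul_le_add n2 m2 _; rewrite mulnC addnC.
    by split; apply: (@expnI 2).
  subst m n; rewrite !expn1 in vm wn fm gn fgE vwE.
  apply: linearly_isomorphic_trans square_cross; rewrite cube_cartesian.
  by apply: linearly_isomorphic_cartesian; [apply: cubeP | apply: cubeQ];
    rewrite ?expn1; nia.
- rewrite addn1 expnS expnD => vgE; left.
  (* Both summands of v w (f + g) must attain their bounds. *)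
  have {}vfw : (v * w * f = m * 2 * (2 ^ m * 2 ^ n))%N by nia.
  have {}wgv : (v * w * g = n * 2 * (2 ^ m * 2 ^ n))%N by nia.
  have wE : w = (2 ^ n)%N.
    have mm0 : (0 < m * 2 * 2 ^ m)%N by rewrite !muln_gt0 m0.
    by apply/eqP; rewrite eqn_leq wn -(leq_pmul2l mm0); nia.
  have vE : v = (2 ^ m)%N.
    have nn0 : (0 < n * 2 * 2 ^ n)%N by rewrite !muln_gt0 n0.
    by apply/eqP; rewrite eqn_leq vm -(leq_pmul2l nn0); nia.
  rewrite vE wE; split=> //.
  have ab0 : (0 < 2 ^ m * 2 ^ n)%N by rewrite muln_gt0 m_gt0.
  by apply/eqP; rewrite -(eqn_pmul2l ab0); apply/eqP; nia.
Qed.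

Lemma hanner_counts N (P : set 'rV[R]_N) : hanner P ->
  exists V F, dual_pair P V F /\ extremal_counts P (size V) (size F).
Proof.
elim=> {N P} [|N P _ [V [F [VF PVF]]]|
  m n P Q _ [V [F [VF PVF]]] _ [W [G [WG QWG]]]].
- exists (segment_ends R), (segment_ends R).
  by split; [apply: dual_pair_segment | apply: extremal_counts_segment].
- by exists F, V; split; [apply: dual_pair_polar | apply: extremal_counts_polar].
- exists (seq_prod V W), (seq_sum F G); split; first exact: dual_pair_prod.
  by rewrite size_seq_prod size_seq_sum; apply: extremal_counts_cartesian.
Qed.

End HannerCounts.
(** * Affine invariance of face numbers *)

Section AffineInvariance.
Local Open Scope classical_set_scope.
Local Open Scope ring_scope.
Variable R : realType.

Lemma card_fset_set_inj (T U : choiceType) (h : T -> U) (S : set T) :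
    {in S &, injective h} ->
  #|` fset_set (h @` S)| = #|` fset_set S|.
Proof.
move=> hS; have hSS : (h @` S #= S)%card by apply: inj_card_eq.
have [/finite_setP[n Sn]|Sinf] := pselect (finite_set S).
  by rewrite (card_fset_set Sn) (card_fset_set (card_eq_trans hSS Sn)).
have hSinf : ~ finite_set (h @` S) by rewrite (eq_finite_set hSS).
by rewrite /fset_set; do 2 case: pselect => //.
Qed.

(** Injectivity on P only controls differences of points of P; by convexity their
    multiples already form the whole direction space.  A sum t (x - y) + s (z - w)
    is (t + s) times the difference of two convex combinations. *)
Lemma convex_directions N (P : set 'rV[R]_N) a m (W : 'M[R]_(m, N)) u :
    convex_set P -> spans_at P a W -> (u <= W)%MS ->
  exists t x y, [/\ P x, P y & u = t *: (x - y)].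
Proof.
move=> /convexP cP [Pa PW _] /submxP[D ->].
suff [t [x [y [_ Px Py ->]]]] :
    exists t x y, [/\ 0 < t, P x, P y & D *m W = t *: (x - y)].
  by exists t, x, y.
rewrite mulmx_sum_row.
apply: (big_ind (fun u => exists t x y, [/\ 0 < t, P x, P y & u = t *: (x - y)])).
- by exists 1, a, a; rewrite subrr scaler0; split.
- move=> _ _ [t [x [y [t0 Px Py ->]]]] [s [z [w [s0 Pz Pw ->]]]].
  have ts0 : 0 < t + s by rewrite addr_gt0.
  pose r := t / (t + s).
  have r01 : 0 <= r <= 1.
    apply/andP; split; first by rewrite divr_ge0 // ltW.
    by rewrite ler_pdivrMr // mul1r lerDl ltW.
  exists (t + s), (r *: x + (1 - r) *: z), (r *: y + (1 - r) *: w).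
  split; [by [] | exact: cP | exact: cP | ].
  by apply/rowP => i; rewrite !mxE /r; field; rewrite gt_eqF.
- move=> i _; case: (ltrgt0P (D 0 i)) => [Di|Di|->].
  + by exists (D 0 i), (a + row i W), a; split=> //; rewrite addrC addKr.
  + exists (- D 0 i), a, (a + row i W); split=> //; first by rewrite oppr_gt0.
    by rewrite opprD addNKr scaleNr scalerN opprK.
  + by exists 1, a, a; rewrite subrr scaler0 scale0r; split.
Qed.

(** The linear part A is injective on the direction space of P, spanned by W, so
    the pseudo-inverse of W *m A recovers directions from their images. *)
Lemma affine_left_inverse m n (P : set 'rV[R]_m) (Q : set 'rV[R]_n) :
    convex_set P -> affinely_isomorphic P Q ->
  exists (A : 'M[R]_(m, n)) (b : 'rV[R]_n) (B : 'M[R]_(n, m)),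
    Q = [set x *m A + b | x in P] /\
    forall x y, P x -> P y -> (x - y) *m A *m B = x - y.
Proof.
move=> convP [A [b [PQfun PQinj PQsurj]]].
exists A, b.
suff [B BP] : exists B : 'M[R]_(n, m),
    forall x y, P x -> P y -> (x - y) *m A *m B = x - y.
  exists B; split=> //; apply/seteqP; split=> [y Qy|_ [x Px <-]].
    by have [x Px <-] := PQsurj y Qy; exists x.
  exact: PQfun.
have [[a Pa]|P0] := pselect (exists a, P a); last first.
  by exists 0 => x y Px; case: P0; exists x.
have [k [W PW]] := spans_at_exists Pa.
have kerA (u : 'rV[R]_m) : (u <= W)%MS -> u *m A = 0 -> u = 0.
  move=> uW; have [t [x [y [Px Py ->]]]] := convex_directions convP PW uW.
  have [->|t0] := eqVneq t 0; first by rewrite scale0r.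
  rewrite -scalemxAl mulmxBl => /eqP; rewrite scaler_eq0 (negPf t0) subr_eq0 /=.
  move=> /eqP xy; rewrite (PQinj x y) ?subrr ?scaler0 //; first exact: mem_set.
  - exact: mem_set.
  - by rewrite xy.
exists (pinvmx (W *m A) *m W) => x y Px Py.
have xyW : (x - y <= W)%MS.
  have -> : x - y = (x - a) - (y - a) by apply/rowP => i; rewrite !mxE; ring.
  by case: PW => _ _ PW; rewrite addmx_sub ?eqmx_opp ?PW.
apply/subr0_eq/kerA.
  by rewrite addmx_sub ?eqmx_opp // !mulmxA submxMl.
apply/eqP; rewrite mulmxBl subr_eq0; apply/eqP.
by rewrite -[RHS](mulmxKpV (submxMr A xyW)) !mulmxA.
Qed.

Section AffineImage.
Variables (m n : nat) (P : set 'rV[R]_m).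
Variables (A : 'M[R]_(m, n)) (b : 'rV[R]_n) (B : 'M[R]_(n, m)).
Hypothesis AB : forall x y, P x -> P y -> (x - y) *m A *m B = x - y.

Let phi (x : 'rV[R]_m) := x *m A + b.

Let phiB x y : phi x - phi y = (x - y) *m A.
Proof. by rewrite /phi opprD addrACA subrr addr0 mulmxBl. Qed.

Lemma affine_image_inj x y : P x -> P y -> phi x = phi y -> x = y.
Proof.
by move=> Px Py /eqP; rewrite -subr_eq0 phiB => /eqP xy;
  apply/subr0_eq; rewrite -(AB Px Py) xy mul0mx.
Qed.

Lemma has_dim_affine_image F k : F `<=` P -> has_dim (phi @` F) k <-> has_dim F k.
Proof.
move=> FP; have [[a Fa]|F0] := pselect (exists a, F a); last first.
  by split=> /has_dim_neq0[x]; [case=> y Fy | move=> Fy]; case: F0;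
    [exists y | exists x].
have [p [W FW]] := spans_at_exists Fa.
have phiW : spans_at (phi @` F) (phi a) (W *m A).
  case: FW => _ FW WF; split=> [|i|_ [x Fx <-]]; first by exists a.
    exists (a + row i W) => //; apply: (addIr (- phi a)).
    by rewrite phiB row_mul addrC addKr [in RHS]addrC addKr.
  by rewrite phiB submxMr // WF.
rewrite (has_dim_spans_at _ phiW) (has_dim_spans_at _ FW).
suff -> : \rank (W *m A) = \rank W by [].
apply/eqP; rewrite eqn_leq mxrankM_maxl /=.
have {1}<- : W *m A *m B = W; last exact: mxrankM_maxl.
apply/row_matrixP => i; rewrite !row_mul.
have -> : row i W = (a + row i W) - a by rewrite addrC addKr.
by case: FW => _ FW _; apply: AB; apply: FP.
Qed.

(** The functional c transported by the left inverse B agrees with c on P up to a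
    constant. *)
Lemma face_affine_image F : face P F -> face (phi @` P) (phi @` F).
Proof.
move=> [c [delta [cP FE]]].
have [[a Pa]|P0] := pselect (exists a, P a); last first.
  have P0' : P = set0 by apply/seteqP; split=> // x Px; case: P0; exists x.
  rewrite FE P0' set0I image_set0.
  by exists 0, 0; split=> [x []//|]; rewrite set0I.
have cphi x : P x ->
    dotp (c *m B^T) (phi x) = dotp (c *m B^T) (phi a) + dotp c x - dotp c a.
  move=> Px; rewrite -addrA -dotpBr -(AB Px Pa) dotp_mulmx -phiB dotpBr; ring.
exists (c *m B^T), (dotp (c *m B^T) (phi a) + delta - dotp c a).
split=> [_ [x Px <-]|]; first by rewrite cphi //; have := cP _ Px; lra.
apply/seteqP; split=> [_ [x Fx <-]|_ [[x Px <-] /= cx]].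
  have [Px /= cx] : (P `&` [set x | dotp c x = delta]) x by rewrite -FE.
  by split; [exists x | rewrite /= cphi // cx].
by exists x => //; rewrite FE; split=> //=; move: cx; rewrite cphi //; lra.
Qed.

Lemma face_affine_preimage G : face (phi @` P) G ->
  exists2 F, face P F & phi @` F = G.
Proof.
move=> [c [delta [cQ ->]]].
have cphi x : dotp c (phi x) = dotp (c *m A^T) x + dotp c b.
  by rewrite dotpDr dotp_mulmx.
exists (P `&` [set x | dotp (c *m A^T) x = delta - dotp c b]).
  exists (c *m A^T), (delta - dotp c b); split=> // x Px.
  by have := cQ _ (imageP phi Px); rewrite cphi; lra.
apply/seteqP; split=> [_ [x [Px /= cx] <-]|_ [[x Px <-] /= cx]].
  by split; [exists x | rewrite /= cphi cx; ring].
by exists x => //; split=> //=; move: cx; rewrite cphi; lra.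
Qed.

Lemma f_num_affine_image k : f_num k (phi @` P) = f_num k P.
Proof.
rewrite /f_num -(card_fset_set_inj (h := fun F => phi @` F)); last first.
  have faceP F : face P F -> F `<=` P by move=> [c [delta [_ ->]]] x [].
  have sub F G : face P F -> face P G -> phi @` F = phi @` G -> F `<=` G.
    move=> /faceP FP /faceP GP FG x Fx.
    have [y Gy yx] : (phi @` G) (phi x) by rewrite -FG; exists x.
    by rewrite -(affine_image_inj (GP _ Gy) (FP _ Fx) yx).
  move=> F G /set_mem[/= FP _] /set_mem[/= GP _] FG.
  by apply/seteqP; split; apply: sub.
congr (#|` fset_set _|); apply/seteqP; split=> [G /= [GQ Gk]|_ [F /= [FP Fk] <-]].
  have [F FP FG] := face_affine_preimage GQ; exists F => //=; split=> //.
  apply/has_dim_affine_image; last by rewrite FG.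
  by case: FP => [c [delta [_ ->]]] x [].
split; first exact: face_affine_image.
by apply/has_dim_affine_image => //; case: FP => [c [delta [_ ->]]] x [].
Qed.

End AffineImage.

Lemma affine_invariance m n (P : set 'rV[R]_m) (Q : set 'rV[R]_n) k :
    convex_set P -> affinely_isomorphic P Q ->
  (has_dim P k <-> has_dim Q k) /\ f_num k P = f_num k Q.
Proof.
move=> cP /(affine_left_inverse cP)[A [b [B [-> AB]]]].
split; first by apply: iff_sym; apply: has_dim_affine_image AB _ _ _.
by rewrite (f_num_affine_image _ AB).
Qed.

End AffineInvariance.
(** * Perfect matchings and regular matrices *)

Section Hall.
Import boot.fintype boot.finset.
Variables (T : finType) (e : rel T).
Implicit Types (A B S : {set T}).

Definition neighbours B S := [set u in B | [exists x in S, e x u]].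

Lemma neighboursP B S u :
  reflect (u \in B /\ exists2 x, x \in S & e x u) (u \in neighbours B S).
Proof.
rewrite inE; apply: (iffP andP) => [[uB /exists_inP ux]|[uB ux]]; split=> //.
exact/exists_inP.
Qed.

(** Halmos-Vaughan induction on A.  If a nonempty proper subset S of A has exactly
    #|S| neighbours, match S into them and A minus S into the rest; otherwise every
    such S has a spare neighbour, and any edge from a chosen point can be removed
    together with its endpoints. *)
Lemma hall_marriage A B : (forall S, S \subset A -> #|S| <= #|neighbours B S|) ->
  exists f : T -> T, {in A &, injective f} /\
                     {in A, forall x, f x \in B /\ e x (f x)}.
Proof.
have [n] := ubnP #|A|; elim: n A B => // n IH A B /ltnSE An hallA.
have [->|[a Aa]] := set_0Vmem A; first by exists id; split=> x; rewrite inE.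
have [[S [SA S0 SnA tight]]|notight] := pselect (exists S : {set T},
  [/\ S \subset A, S != set0, S != A & #|S| = #|neighbours B S|]).
- have SltA : S \proper A by rewrite properEneq SnA.
  have [||f1 [f1inj f1P]] := IH S (neighbours B S).
  + exact: leq_trans (proper_card SltA) An.
  + move=> S' S'S; apply: leq_trans (hallA S' (subset_trans S'S SA)) _.
    apply/subset_leq_card/subsetP => u /neighboursP[uB [x xS' xu]].
    apply/neighboursP; split; last by exists x.
    by apply/neighboursP; split=> //; exists x => //; apply: (subsetP S'S).
  have [||f2 [f2inj f2P]] := IH (A :\: S) (B :\: neighbours B S).
  + apply: leq_trans An; apply: proper_card; rewrite properE subsetDl /=.
    have [x Sx] := set0Pn _ S0; apply/subsetPn; exists x; rewrite ?(subsetP SA) //.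
    by rewrite inE Sx.
  + move=> S' S'A.
    have dis : [disjoint S & S'].
      rewrite disjoint_sym disjoints_subset; apply: subset_trans S'A _.
      by rewrite setDE subsetIr.
    have := hallA (S :|: S'); rewrite subUset SA (subset_trans S'A (subsetDl _ _)).
    move=> /(_ erefl); rewrite cardsU (disjoint_setI0 dis) cards0 subn0 {1}tight.
    move=> le1; rewrite -(leq_add2l #|neighbours B S|); apply: leq_trans le1 _.
    apply: leq_trans (leq_card_setU _ _).
    apply/subset_leq_card/subsetP => u /neighboursP[uB [x xSS' xu]].
    rewrite in_setU; have [//|uN /=] := boolP (u \in neighbours B S).
    apply/neighboursP; rewrite inE uN uB; split=> //; exists x => //.
    move: xSS'; rewrite inE => /orP[xS|//].
    by case/negP: uN; apply/neighboursP; split=> //; exists x.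
  exists (fun x => if x \in S then f1 x else f2 x); split=> [x y xA yA|x xA] /=.
    have memf2 z : z \in A -> z \notin S -> f2 z \notin neighbours B S.
      by move=> zA zS; have [|+ _] := f2P z; rewrite ?inE ?zS // => /andP[].
    have memf1 z : z \in S -> f1 z \in neighbours B S by move=> /f1P[].
    case: ifPn => xS; case: ifPn => yS.
    - exact: f1inj.
    - by move=> xy; have := memf2 _ yA yS; rewrite -xy memf1.
    - by move=> xy; have := memf2 _ xA xS; rewrite xy memf1.
    - by apply: f2inj; rewrite inE ?xS ?yS.
  case: ifPn => xS; first by have [/neighboursP[]] := f1P x xS.
  by have [|+ ?] := f2P x; rewrite ?inE ?xS // => /andP[].
- have [u uB au] : exists2 u, u \in B & e a u.
    have := hallA [set a]; rewrite sub1set Aa cards1 => /(_ erefl) /card_gt0P[u].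
    by case/neighboursP=> uB [x /set1P-> au]; exists u.
  have [||f [finj fP]] := IH (A :\ a) (B :\ u).
  + by apply: leq_trans An; rewrite [ltnRHS](cardsD1 a) Aa.
  + move=> S SA; have [->|S0] := eqVneq S set0; first by rewrite cards0.
    have SsubA : S \subset A by apply: subset_trans SA (subsetDl _ _).
    have : #|S| < #|neighbours B S|.
      rewrite ltn_neqAle hallA // andbT; apply/eqP => tight.
      apply: notight; exists S; split=> //; apply/eqP => SA'.
      by move: SA; rewrite SA' => /subsetP/(_ a Aa); rewrite !inE eqxx.
    move=> lt; rewrite -ltnS; apply: leq_trans lt _.
    apply: (@leq_trans #|u |: neighbours (B :\ u) S|); last first.
      by rewrite cardsU1 -add1n leq_add2r; case: (_ \notin _).
    apply/subset_leq_card/subsetP => v /neighboursP[vB vx].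
    rewrite in_setU1; have [//|vu /=] := eqVneq v u.
    by apply/neighboursP; rewrite !inE vu vB.
  exists (fun x => if x == a then u else f x); split=> [x y xA yA|x xA] /=.
    have fu z : z \in A -> z != a -> f z != u.
      by move=> zA za; have [|+ _] := fP z; rewrite !inE ?za // => /andP[].
    have [->|xa] := eqVneq x a; have [->|ya] := eqVneq y a => //.
    - by move=> uf; have := fu _ yA ya; rewrite -uf eqxx.
    - by move=> uf; have := fu _ xA xa; rewrite uf eqxx.
    - by apply: finj; rewrite !inE ?xa ?ya.
  have [->//|xa] := eqVneq x a.
  by have [|+ ?] := fP x; rewrite !inE ?xa // => /andP[].
Qed.

End Hall.

Section Konig.
Import boot.fintype boot.finset.
Variable n : nat.
Implicit Types (M : 'I_n -> 'I_n -> nat) (s : 'S_n).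

Definition regular k M : Prop :=
  (forall i, \sum_j M i j = k) /\ (forall j, \sum_i M i j = k).

(** Double counting of the entries in the rows of S gives Hall's condition. *)
Lemma regular_perm k M : 0 < k -> regular k M -> exists s, forall i, 0 < M i (s i).
Proof.
move=> k0 [rowM colM]; pose e : rel 'I_n := fun i j => 0 < M i j.
have [S _|f [finj fP]] := @hall_marriage _ e [set: 'I_n] [set: 'I_n].
  rewrite -(leq_pmul2r k0) -!sum_nat_const.
  rewrite -(eq_bigr _ (fun i _ => rowM i)) -(eq_bigr _ (fun j _ => colM j)).
  rewrite [leqRHS]exchange_big /=.
  apply: (@leq_trans (\sum_(i in S) \sum_(j in neighbours e setT S) M i j)).
    apply: leq_sum => i iS; rewrite [leqLHS](bigID (mem (neighbours e setT S))) /=.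
    rewrite [X in _ + X]big1 ?addn0 // => j /neighboursP jN.
    apply/eqP; rewrite -leqn0 leqNgt; apply/negP => Mij.
    by case: jN; split; rewrite ?inE //; exists i.
  by rewrite [leqRHS](bigID (mem S)) leq_addr.
have finj' : injective f by move=> x y; apply: finj; rewrite inE.
by exists (perm finj') => i; rewrite permE; have [] := fP i; rewrite inE.
Qed.

Lemma sum_perm_row s i : \sum_j (s i == j) = 1.
Proof.
by rewrite (bigD1 (s i)) //= eqxx big1 // => j; rewrite eq_sym => /negPf->. Qed.

Lemma sum_perm_col s j : \sum_i (s i == j) = 1.
Proof.
rewrite (bigD1 (s^-1 j)%g) //= permKV eqxx big1 // => i.
by rewrite (canF_eq (permK s)) => /negPf->.
Qed.

Lemma regular_sub_perm k M s : regular k M -> (forall i, 0 < M i (s i)) ->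
  regular k.-1 (fun i j => M i j - (s i == j)).
Proof.
move=> [rowM colM] Ms.
have le i j : (s i == j) <= M i j by case: eqVneq => [<-|].
by split=> [i|j]; rewrite sumnB // ?rowM ?colM ?sum_perm_row ?sum_perm_col subn1.
Qed.

Local Open Scope ring_scope.

Lemma sum_mul_perm (R : realType) (c : 'I_n -> 'I_n -> R) s i :
  \sum_j c i j * (s i == j)%:R = c i (s i).
Proof.
rewrite (bigD1 (s i)) //= eqxx mulr1 big1 ?addr0 // => j.
by rewrite eq_sym => /negPf->; rewrite mulr0.
Qed.

(** Konig's theorem in the form of an inequality: a k-regular matrix of natural
    numbers is a sum of k permutation matrices, each of weight at most delta. *)
Lemma regular_sum_le (R : realType) (c : 'I_n -> 'I_n -> R) (delta : R) k M :
    (forall s, \sum_i c i (s i) <= delta) -> regular k M ->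
  \sum_i \sum_j c i j * (M i j)%:R <= k%:R * delta.
Proof.
move=> cs; elim: k M => [|k IH] M regM.
  rewrite mul0r big1 // => i _; rewrite big1 // => j _.
  have [/(_ i)/eqP + _] := regM; rewrite sum_nat_eq0 => /forallP/(_ j) /eqP ->.
  by rewrite mulr0.
have [s Ms] := regular_perm (ltn0Sn k) regM.
have := IH _ (regular_sub_perm regM Ms); rewrite /= => IHM.
have -> : \sum_i \sum_j c i j * (M i j)%:R =
    \sum_i \sum_j c i j * (M i j - (s i == j))%N%:R + \sum_i c i (s i).
  rewrite -big_split; apply: eq_bigr => i _ /=.
  rewrite -(sum_mul_perm c) -big_split; apply: eq_bigr => j _ /=.
  rewrite -mulrDr -natrD subnK //; case: eqVneq => [<-|//]; exact: Ms.
by have := cs s; rewrite -(natr1 k); lra.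
Qed.

End Konig.
(** * Vertices and facets of Birkhoff polytopes *)

Section Birkhoff.
Local Open Scope classical_set_scope.
Local Open Scope ring_scope.
Variable R : realType.

Lemma dotp_mxvec m n (X Y : 'M[R]_(m, n)) :
  dotp (mxvec X) (mxvec Y) = \sum_i \sum_j X i j * Y i j.
Proof.
rewrite /dotp pair_bigA /= (reindex (uncurry (@mxvec_index m n))) /=.
  by apply: eq_bigr => -[i j] _ /=; rewrite !mxvecE.
exact: curry_mxvec_bij.
Qed.

Definition perm_point n (s : 'S_n) : 'rV[R]_(n * n) := mxvec (perm_mx s).
Definition perm_points n : seq 'rV[R]_(n * n) :=
  [seq perm_point s | s <- enum 'S_n].

Lemma perm_point_in n (s : 'S_n) : perm_point s \in perm_points n.
Proof. by apply: map_f; rewrite mem_enum. Qed.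

Lemma perm_pointsP n v : v \in perm_points n -> exists s, v = perm_point s.
Proof. by case/mapP=> s _ ->; exists s. Qed.

Lemma birkhoffE n : @birkhoff R n = conv_hull [set` perm_points n].
Proof.
congr conv_hull; apply/seteqP; split=> [_ [s _ <-]|v /perm_pointsP[s ->]].
  exact: perm_point_in.
by exists s.
Qed.

Lemma birkhoff_perm_point n (s : 'S_n) : @birkhoff R n (perm_point s).
Proof. by rewrite birkhoffE; apply: conv_hull_sub; apply: perm_point_in. Qed.

Lemma dotp_perm_point n (C : 'M[R]_n) (s : 'S_n) :
  dotp (mxvec C) (perm_point s) = \sum_i C i (s i).
Proof.
rewrite dotp_mxvec; apply: eq_bigr => i _.
by rewrite -(sum_mul_perm (fun i j => C i j)); apply: eq_bigr => j _; rewrite !mxE.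
Qed.

Lemma perm_point_inj n : injective (@perm_point n).
Proof.
move=> s t /(can_inj mxvecK) /matrixP st; apply/permP => i.
have := st i (s i); rewrite !mxE eqxx; case: eqVneq => // _ /eqP.
by rewrite oner_eq0.
Qed.

(** All permutation matrices have squared norm n, so each one is exposed by the
    functional that it defines, by the strict Cauchy-Schwarz inequality. *)
Lemma f_num_birkhoff_vertices n : f_num 0 (@birkhoff R n) = n`!.
Proof.
have size_points : size (perm_points n) = n`! by rewrite size_map -cardE card_Sn.
rewrite -size_points; apply: f_num_vertices (birkhoffE n) _.
  by rewrite map_inj_uniq ?enum_uniq //; apply: perm_point_inj.
move=> v /perm_pointsP[s ->]; exists (perm_point s) => w /perm_pointsP[t ->] neq.
have norm (r : 'S_n) : dotp (perm_point r) (perm_point r) = n%:R.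
  rewrite dotp_perm_point (eq_bigr (fun=> 1)) ?sumr_const ?card_ord // => i _.
  by rewrite !mxE eqxx.
have : perm_point t - perm_point s != 0 by rewrite subr_eq0.
move=> /dotp_gt0; rewrite dotpBr [dotp _ (perm_point t)]dotpC.
rewrite [dotp _ (perm_point s)]dotpC !dotpBr !norm.
by rewrite [dotp (perm_point t) _]dotpC; lra.
Qed.

Definition entry_zero n (i j : 'I_n) : set 'rV[R]_(n * n) :=
  [set x | vec_mx x i j = 0].

Lemma vec_mx_dotp n (i j : 'I_n) (x : 'rV[R]_(n * n)) :
  vec_mx x i j = dotp (mxvec (delta_mx i j)) x.
Proof.
rewrite -{2}(vec_mxK x) dotp_mxvec; move: (vec_mx x) => X.
rewrite (bigD1 i) //= (bigD1 j) //= mxE !eqxx mul1r.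
rewrite !big1 ?addr0 // => [k /negPf ki|k /negPf kj].
  by rewrite big1 // => l _; rewrite mxE ki mul0r.
by rewrite mxE kj andbF mul0r.
Qed.

Lemma birkhoff_entry_ge0 n (i j : 'I_n) x : @birkhoff R n x -> 0 <= vec_mx x i j.
Proof.
rewrite birkhoffE vec_mx_dotp => Vx.
apply: (conv_hull_ge Vx) => v /perm_pointsP[s ->].
by rewrite -vec_mx_dotp mxvecK !mxE ler0n.
Qed.

Lemma entry_face n (i j : 'I_n) :
  face (@birkhoff R n) (@birkhoff R n `&` entry_zero i j).
Proof.
exists (- mxvec (delta_mx i j)), 0; split=> [x Px|].
  by rewrite dotpNl -vec_mx_dotp oppr_le0; apply: birkhoff_entry_ge0.
apply/seteqP; split=> x [Px /= x0]; split=> //=.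
  by rewrite dotpNl -vec_mx_dotp x0 oppr0.
by apply: oppr_inj; rewrite oppr0 -x0 dotpNl -vec_mx_dotp.
Qed.

Lemma exists_perm_entry n (i j : 'I_n) : exists s : 'S_n, s i = j.
Proof. by exists (tperm i j); rewrite tpermL. Qed.

(** Entries are nonnegative on the polytope, so x_ij = 0 defines a face; it is a
    proper one, hence has the dimension of the facet that it contains. *)
Lemma facet_sub_entry_zero n d F (i j : 'I_n) : has_dim (@birkhoff R n) d ->
    (0 < d)%N -> face (@birkhoff R n) F -> has_dim F (d - 1) ->
  (forall s, F (perm_point s) -> s i != j) -> F = @birkhoff R n `&` entry_zero i j.
Proof.
move=> Pd d0 FP Fd Fs.
have FPsub : F `<=` @birkhoff R n by case: FP => c [delta [_ ->]] x [].
have FG : F `<=` @birkhoff R n `&` entry_zero i j.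
  move=> x Fx; split; first exact: FPsub.
  have [c [delta [cP FE]]] := FP.
  have [Px /= cx] : (@birkhoff R n `&` [set x | dotp c x = delta]) x by rewrite -FE.
  rewrite birkhoffE in Px.
  apply: (conv_hull_face _ _ _ Px cx) => [|v|_ /perm_pointsP[s ->] cs].
  - apply/convexP => y z t /= y0 z0 _.
    rewrite /entry_zero /= vec_mx_dotp dotpDr !dotpZr -!vec_mx_dotp y0 z0.
    by rewrite !mulr0 addr0.
  - by move=> /perm_pointsP[s ->]; apply: (cP); apply: birkhoff_perm_point.
  - have /Fs : F (perm_point s).
      by rewrite FE; split=> //; apply: birkhoff_perm_point.
    by move=> /negPf sij; rewrite /entry_zero /= mxvecK !mxE sij.
have GP : @birkhoff R n `&` entry_zero i j `<=` @birkhoff R n by move=> x [].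
have [a Fa] := has_dim_neq0 Fd.
have [k Gk] := has_dim_exists (FG _ Fa).
have kd : k != d.
  apply/eqP => kd; rewrite kd in Gk.
  have [s sij] := exists_perm_entry i j.
  have := birkhoff_perm_point s.
  rewrite -(face_eq_of_dim (entry_face i j) GP (fun=> id) Gk Pd) => -[_].
  by rewrite /entry_zero /= mxvecK !mxE sij eqxx => /eqP; rewrite oner_eq0.
have k_ge := has_dim_le FG Fd Gk; have k_le := has_dim_le GP Gk Pd.
have kE : k = (d - 1)%N by move/eqP: kd; lia.
by apply: face_eq_of_dim FP FG GP Fd _; rewrite -kE.
Qed.

(** Let M be the sum of the matrices of the permutations sg i j in the face, so that
    c.M = n^2 delta and M has positive entries.  For a permutation s, the matrix
    M - s is (n^2 - 1)-regular, so c.(M - s) <= (n^2 - 1) delta and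
    c.s >= delta. *)
Lemma face_full n F : (0 < n)%N -> face (@birkhoff R n) F ->
  (forall i j : 'I_n, exists s, F (perm_point s) /\ s i = j) -> F = @birkhoff R n.
Proof.
move=> n0 [c [delta [cP FE]]] /(_ _ _)/cid Fs.
pose sg i j := projT1 (Fs i j).
have Fsg i j : F (perm_point (sg i j)) by have [] := projT2 (Fs i j).
have sgij i j : sg i j i = j by have [] := projT2 (Fs i j).
pose C := vec_mx c.
have cE (s : 'S_n) : dotp c (perm_point s) = \sum_i C i (s i).
  by rewrite -dotp_perm_point vec_mxK.
have C_le (s : 'S_n) : \sum_i C i (s i) <= delta.
  by rewrite -cE; apply: (cP); apply: birkhoff_perm_point.
have C_eq i j : \sum_k C k (sg i j k) = delta.
  by rewrite -cE; have := Fsg i j; rewrite FE => -[].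
pose M a b := (\sum_(p : 'I_n * 'I_n) (sg p.1 p.2 a == b))%N.
have card_pairs : (\sum_(p : 'I_n * 'I_n) 1 = n * n)%N.
  by rewrite sum1_card card_prod card_ord.
have M_regular : regular (n * n) M.
  split=> [a|b]; rewrite /M exchange_big /= -[RHS]card_pairs;
    apply: eq_bigr => p _.
    exact: sum_perm_row.
  exact: sum_perm_col.
have M_gt0 a b : (0 < M a b)%N.
  by rewrite /M (bigD1 (a, b)) //= sgij eqxx.
have sumM : \sum_a \sum_b C a b * (M a b)%:R = (n * n)%:R * delta.
  transitivity (\sum_(p : 'I_n * 'I_n) \sum_a C a (sg p.1 p.2 a)).
    rewrite [RHS]exchange_big; apply: eq_bigr => a _ /=.
    under eq_bigr do rewrite natr_sum mulr_sumr.
    rewrite exchange_big; apply: eq_bigr => p _ /=.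
    exact: (sum_mul_perm (fun i j => C i j)).
  under eq_bigr do rewrite C_eq.
  by rewrite sumr_const card_prod card_ord mulr_natl.
have C_ge (s : 'S_n) : delta <= \sum_i C i (s i).
  have := regular_sum_le C_le (regular_sub_perm M_regular (fun i => M_gt0 i (s i))).
  have -> : \sum_a \sum_b C a b * (M a b - (s a == b))%N%:R =
      (n * n)%:R * delta - \sum_i C i (s i).
    rewrite -sumM -sumrB; apply: eq_bigr => a _.
    rewrite -(sum_mul_perm (fun i j => C i j)) -sumrB; apply: eq_bigr => b _.
    rewrite -mulrBr natrB //; case: eqVneq => // <-; exact: M_gt0.
  have -> : (n * n)%:R = (n * n).-1%:R + 1 :> R.
    by rewrite natr1 prednK ?muln_gt0 ?n0.
  by lra.
rewrite FE; apply/seteqP; split=> [x []//|x Px]; split=> //=.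
apply/eqP; rewrite eq_le cP //=; rewrite birkhoffE in Px.
by apply: (conv_hull_ge Px) => _ /perm_pointsP[s ->]; rewrite cE C_ge.
Qed.

Lemma f_num_birkhoff_facets n d :
    (0 < n)%N -> has_dim (@birkhoff R n) d -> (0 < d)%N ->
  (f_num (d - 1) (@birkhoff R n) <= n * n)%N.
Proof.
move=> n0 Pd d0; pose h (p : 'I_n * 'I_n) := @birkhoff R n `&` entry_zero p.1 p.2.
pose s := [seq h p | p <- enum {: 'I_n * 'I_n}].
have sub : [set F | face (@birkhoff R n) F /\ has_dim F (d - 1)] `<=`
    [set` [fset F in s]%fset].
  move=> F [FP Fd] /=; rewrite inE /=; apply: contrapT => notF.
  have Fs i j : exists s, F (perm_point s) /\ s i = j.
    apply: contrapT => Fij; apply: notF; apply/mapP; exists (i, j).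
      by rewrite mem_enum.
    apply: facet_sub_entry_zero Pd d0 FP Fd _ => t Ft.
    by apply/eqP => tij; apply: Fij; exists t.
  rewrite (face_full n0 FP Fs) in Fd; have := has_dim_inj Fd Pd; lia.
have sfin : finite_set [set` [fset F in s]%fset] by apply: finite_fset.
apply: (@leq_trans #|` [fset F in s]%fset|).
  apply: fsubset_leq_card; rewrite -[X in (_ `<=` X)%fset]set_fsetK.
  rewrite -fset_set_sub //; exact: sub_finite_set sfin.
rewrite card_fseq (leq_trans (size_undup _)) //.
by rewrite size_map -cardE card_prod card_ord.
Qed.

End Birkhoff.
(** * Dimension of Birkhoff polytopes and the two-by-two case *)

Section BirkhoffDimension.
Local Open Scope classical_set_scope.
Local Open Scope ring_scope.
Variable R : realType.

(** For i, j > 0 the difference of two permutation matrices that differ by a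
    transposition can be (e_i - e_0)^T (e_j - e_0).  The rows of C are the vectors
    e_i - e_0, so X -> C^T X C sends the m * m unit matrices to such differences;
    it is injective because D is a right inverse of C. *)
Lemma birkhoff_dim_ge m d : has_dim (@birkhoff R m.+1) d -> (m * m <= d)%N.
Proof.
move=> Pd.
pose C : 'M[R]_(m, m.+1) :=
  \matrix_(i, j) ((j == lift ord0 i)%:R - (j == ord0)%:R).
pose D : 'M[R]_(m.+1, m) := \matrix_(j, i) (j == lift ord0 i)%:R.
have CD : C *m D = 1%:M.
  apply/matrixP => i k; rewrite !mxE (bigD1 (lift ord0 k)) //= big1 => [|j jk].
    by rewrite !mxE eqxx mulr1 addr0 (inj_eq lift_inj) subr0 eq_sym.
  by rewrite [D _ _]mxE (negPf jk) mulr0.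
pose L := lin_mx (mulmx C^T \o mulmxr C).
pose L' := lin_mx (mulmx D^T \o mulmxr D).
have LL' : L *m L' = 1%:M.
  apply/row_matrixP => i; rewrite !rowE mulmx1 mulmxA -[delta_mx 0 i]vec_mxK.
  rewrite mul_vec_lin mul_vec_lin /= -!mulmxA CD mulmx1 mulmxA -trmx_mul CD.
  by rewrite trmx1 mul1mx.
have rL : (m * m <= \rank L)%N by rewrite -[leqLHS](mxrank1 R) -LL' mxrankM_maxl.
apply: leq_trans rL _.
pose a : 'rV[R]_(m.+1 * m.+1) := perm_point R 1.
have [k [W PW]] := spans_at_exists (@birkhoff_perm_point R _ 1 : birkhoff a).
move: Pd => /(has_dim_spans_at _ PW) <-.
apply: mxrankS; apply/row_subP => i.
case/mxvec_indexP: i => x y.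
rewrite rowE -mxvec_delta mul_vec_lin /=.
pose s : 'S_m.+1 := tperm (lift ord0 x) (lift ord0 y).
pose t : 'S_m.+1 := (tperm (lift ord0 x) ord0 * s)%g.
have -> : mxvec (C^T *m (delta_mx x y *m C)) = perm_point R s - perm_point R t.
  have l0 r : lift ord0 r != ord0 :> 'I_m.+1 by rewrite eq_sym neq_lift.
  have s0 : s ord0 = ord0 by rewrite tpermD.
  have sx : s (lift ord0 x) = lift ord0 y by rewrite tpermL.
  have t0 : t ord0 = lift ord0 y by rewrite permM tpermR.
  have tx : t (lift ord0 x) = ord0 by rewrite permM tpermL.
  rewrite /perm_point -linearB /=; congr mxvec; apply/matrixP => i j.
  have dC r : (delta_mx x y *m C) r j = (r == x)%:R * C y j.
    rewrite mxE (bigD1 y) //= big1 ?addr0 => [|l ly].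
      by rewrite mxE eqxx andbT.
    by rewrite mxE (negPf ly) andbF mul0r.
  rewrite mxE (bigD1 x) //= big1 ?addr0 => [|r rx]; last first.
    by rewrite dC (negPf rx) mul0r mulr0.
  rewrite dC eqxx mul1r !mxE.
  have [->|ix] := eqVneq i (lift ord0 x).
    by rewrite (negPf (l0 x)) subr0 mul1r sx tx ![_ == j]eq_sym.
  have [->|i0] := eqVneq i ord0.
    by rewrite s0 t0 sub0r mulN1r opprB ![_ == j]eq_sym.
  by rewrite subrr mul0r /t permM [tperm _ ord0 i]tpermD ?subrr // eq_sym.
case: PW => _ _ PW.
have -> : perm_point R s - perm_point R t =
    (perm_point R s - a) - (perm_point R t - a).
  by rewrite opprB addrA subrK.
by rewrite addmx_sub ?eqmx_opp // PW //; apply: birkhoff_perm_point.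
Qed.

(** The top left entry is an affine coordinate on the segment B_2. *)
Lemma birkhoff2_cube : affinely_isomorphic (@birkhoff R 2) (@cube R 1).
Proof.
pose A : 'M[R]_(2 * 2, 1) := 2 *: (mxvec (delta_mx 0 0))^T.
have AE (x : 'rV[R]_(2 * 2)) : (x *m A + const_mx (-1)) 0 0 = 2 * vec_mx x 0 0 - 1.
  by rewrite vec_mx_dotp dotpC dotpE /A -scalemxAr !mxE.
pose p t := t *: perm_point R 1 + (1 - t) *: perm_point R (tperm (0 : 'I_2) 1).
have p00 t : vec_mx (p t) 0 0 = t.
  rewrite vec_mx_dotp dotpDr !dotpZr -!vec_mx_dotp !mxvecK !mxE perm1 tpermL /=.
  by rewrite mulr1 mulr0 addr0.
have S2 (s : 'S_2) : s = 1%g \/ s = tperm 0 1.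
  have I2 (i : 'I_2) : i = 0 \/ i = 1.
    by case: i => [[|[|//]] i2]; [left | right]; apply: val_inj.
  have s01 : s 0 != s 1 by rewrite (inj_eq perm_inj).
  case: (I2 (s 0)) (I2 (s 1)) s01 => s0 [] s1; rewrite s0 s1 ?eqxx // => _.
    by left; apply/permP => i; case: (I2 i) => ->; rewrite perm1.
  by right; apply/permP => i; case: (I2 i) => ->; rewrite ?tpermL ?tpermR.
have PE : @birkhoff R 2 = [set p t | t in [set t : R | 0 <= t <= 1]].
  rewrite birkhoffE; apply/seteqP; split=> [x Px|_ [t /= t01 <-]].
    apply: (conv_hull_ind Px) => {x Px} [_ _ r [t /= t01 <-] [u /= u01 <-] r01|v].
      exists (r * t + (1 - r) * u) => /=; first by nra.
      by apply/rowP => i; rewrite /p !mxE; ring.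
    move=> /perm_pointsP[s ->]; case: (S2 s) => ->.
      by exists 1; rewrite /= ?lexx ?ler01 // /p subrr scale0r scale1r addr0.
    by exists 0; rewrite /= ?lexx ?ler01 // /p subr0 scale0r scale1r add0r.
  move/convexP: (@conv_hull_convex _ _ [set` perm_points R 2]); apply=> //;
    by apply: conv_hull_sub; apply: perm_point_in.
exists A, (const_mx (-1)); rewrite PE; split.
- by move=> _ [t /= t01 <-]; apply/cube1P; rewrite AE p00; lra.
- move=> _ _ /set_mem[t /= t01 <-] /set_mem[u /= u01 <-] /rowP/(_ 0).
  by rewrite !AE !p00 => tu; congr p; lra.
- move=> y /cube1P y1; exists (p ((1 + y 0 0) / 2)).
    by exists ((1 + y 0 0) / 2) => //=; lra.
  by apply/rowP => i; rewrite ord1 AE p00; lra.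
Qed.

End BirkhoffDimension.

(** With m = n - 1, passing from m to m + 1 multiplies the left-hand side by
    (m+2)^3 / (m+1)^2 and the right-hand side by 2^(2m+1) (m+1)^2 / m^2, and
    m (m+2) <= (m+1)^2. *)
Lemma birkhoff_count_lt n d : (3 <= n)%N -> ((n - 1) * (n - 1) <= d)%N ->
  (n`! * (n * n) < d * 2 ^ (d + 1))%N.
Proof.
case: n => [//|m] m2; rewrite subn1 /= => md.
have le2 : (m * m * 2 ^ (m * m + 1) <= d * 2 ^ (d + 1))%N.
  by apply: leq_mul => //; rewrite leq_exp2l // leq_add2r.
apply: leq_trans le2 => {d md}.
elim: m m2 => // m IH; rewrite leq_eqVlt => /predU1P[[<-] //|/IH {}IH].
have m1_gt0 : (0 < m.+1 * m.+1)%N by [].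
rewrite -(ltn_pmul2l m1_gt0) factS.
have -> : (m.+1 * m.+1 + 1 = (m * m + 1) + (2 * m + 1))%N by lia.
rewrite expnD; move: IH; set X := (m.+1)`!; set Y := (2 ^ (m * m + 1))%N => IH.
have Z_ge : (m.+2 <= 2 ^ (2 * m + 1))%N.
  by apply: leq_ltn_trans (ltn_expl _ (ltnSn 1)); lia.
have IH' : (m.+2 * m.+2 * m.+2 * (X * (m.+1 * m.+1)) <
            m.+2 * m.+2 * m.+2 * (m * m * Y))%N by rewrite ltn_pmul2l.
have sq : (m.+2 * m.+2 * (m * m) <= m.+1 * m.+1 * (m.+1 * m.+1))%N by nia.
have := leq_mul (leq_mul sq Z_ge) (leqnn Y).
lia.
Qed.

(** * The bound and its equality case *)

Lemma iso_cube_cross_count (R : realType) (N : nat) (P : set 'rV[R]_N) (d : nat) :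
    (0 < d)%N -> convex_set P ->
    affinely_isomorphic P (@cross_polytope R d) \/
      affinely_isomorphic P (@cube R d) ->
  (f_num 0 P * f_num (d - 1) P = d * 2 ^ (d + 1))%N.
Proof.
move=> d0 cP; have [V [F [VF sV sF]]] := dual_pair_cube R d0.
have [f0 f1] := f_num_dual_pair d0 VF.
have [g0 g1] := f_num_dual_pair d0 (dual_pair_polar VF).
have inv n (Q : set 'rV[R]_n) k : affinely_isomorphic P Q -> f_num k P = f_num k Q.
  by move=> /(affine_invariance k cP)[].
by case=> iso; rewrite !(inv _ _ _ iso) ?g0 ?g1 ?f0 ?f1 sV sF addn1 expnS; lia.
Qed.

Theorem lemma4 (R : realType) (N : nat) (P : set 'rV[R]_N) (d : nat)
    (hP : hanner P \/ is_birkhoff P) (hd : has_dim P d) :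
  (f_num 0 P * f_num (d - 1) P <= d * 2 ^ (d + 1))%N /\
  ((f_num 0 P * f_num (d - 1) P = d * 2 ^ (d + 1))%N <->
   affinely_isomorphic P (@cross_polytope R d) \/
   affinely_isomorphic P (@cube R d)).
Proof.
case: hP => [hanP|birP].
- have [V [F [PVF [[N0 _] vf cubeP crossP extP]]]] := hanner_counts hanP.
  have dN := has_dim_inj hd (has_dim_dual_pair PVF); subst d.
  have cP : convex_set P by rewrite (dual_conv PVF); apply: conv_hull_convex.
  have [f0 f1] := f_num_dual_pair N0 PVF; split; first by rewrite f0 f1.
  split=> [|iso]; last exact: iso_cube_cross_count.
  rewrite f0 f1 => /extP[[vE fE]|[vE fE]].
    by right; apply: linearly_isomorphic_affinely; apply: cubeP.
  by left; apply: linearly_isomorphic_affinely; apply: crossP.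
- case: birP hd => {P N} n n2 hd.
  have cP : convex_set (@birkhoff R n) by apply: conv_hull_convex.
  have n0 : (0 < n)%N by apply: leq_trans n2.
  have d_ge : ((n - 1) * (n - 1) <= d)%N.
    by case: n n2 hd {cP n0} => // m _ hd; rewrite subn1; apply: birkhoff_dim_ge hd.
  have d0 : (0 < d)%N by apply: leq_trans d_ge; rewrite muln_gt0 subn_gt0 n2.
  move: n2; rewrite leq_eqVlt => /predU1P[n2|n3].
    subst n; have d1 : d = 1%N.
      have [[/(_ hd) cd _] _] := affine_invariance d cP (birkhoff2_cube R).
      have [V [F [VF _ _]]] := dual_pair_cube R (ltn0Sn 0).
      exact: has_dim_inj cd (has_dim_dual_pair VF).
    subst d; have iso : affinely_isomorphic (@birkhoff R 2) (@cross_polytope R 1) \/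
        affinely_isomorphic (@birkhoff R 2) (@cube R 1).
      by right; apply: birkhoff2_cube.
    by have eq := iso_cube_cross_count d0 cP iso; rewrite eq; split.
  have lt : (f_num 0 (@birkhoff R n) * f_num (d - 1) (@birkhoff R n) <
             d * 2 ^ (d + 1))%N.
    apply: leq_ltn_trans (birkhoff_count_lt n3 d_ge).
    by rewrite f_num_birkhoff_vertices leq_mul2l f_num_birkhoff_facets ?orbT.
  split; first exact: ltnW.
  by split=> [eq|/(iso_cube_cross_count d0 cP)//]; move: lt; rewrite eq ltnn.
Qed.
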